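(* Let $d,n$ be positive integers. Let $H\subset \mathcal{P}_n^{(d)}$ be a commutative subgroup of the $n$-qudit Pauli group without non-trivial scalars (i.e. $H\cap\{\zeta^a : a\in\mathbb{Z}\}=\{I\}$). Then there are positive divisors $d_1,d_2,\ldots,d_k$ of $d$ such that the following holds: there are a unitary isomorphism $$V^H\simeq \mathbb{C}^{d_1}\otimes \mathbb{C}^{d_2}\otimes \cdots \otimes\mathbb{C}^{d_k}$$ and an isomorphism of groups $$N(H)/H\simeq \mathcal{P}_1^{(d_1,\zeta)}\times_\zeta \mathcal{P}_1^{(d_2,\zeta)}\times_\zeta \cdots\times_\zeta\mathcal{P}_1^{(d_k,\zeta)}$$ such that the action of $N(H)/H$ on $V^H$ is identified with the action of $\mathcal{P}_1^{(d_1,\zeta)}\times_\zeta \cdots\times_\zeta\mathcal{P}_1^{(d_k,\zeta)}$ on $\mathbb{C}^{d_1}\otimes \cdots \otimes\mathbb{C}^{d_k}$.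
   Context: Set $\bar d=d$ if $d$ is odd and $\bar d=2d$ if $d$ is even. Fix a primitive $\bar d$-th root of unity $\zeta\in\mathbb{C}$ and set $\xi=\zeta^2$, a primitive $d$-th root of unity. The space $\mathbb{C}^d$ has an orthonormal basis $\{v_i : i\in\mathbb{Z}/d\mathbb{Z}\}$ and operators $X(v_i)=v_{i+1}$, $Z(v_i)=\xi^i v_i$. Let $V=(\mathbb{C}^d)^{\otimes n}$ with the induced hermitian scalar product. For $r\in\{1,\dots,n\}$, $X_r$ and $Z_r$ denote the operators $X$ and $Z$ acting on the $r$-th tensor factor (identity on the others). The Pauli group $\mathcal{P}_n=\mathcal{P}_n^{(d)}\subset GL(V)$ is the subgroup generated by $X_r,Z_r$ ($1\leq r\leq n$) and by the operator of multiplication by $\zeta$ (also denoted $\zeta$). For a subgroup $H\subset\mathcal{P}_n$, $V^H=\{v\in V : h(v)=v\ \forall h\in H\}$, and $N(H)$ is the normaliser of $H$ in $\mathcal{P}_n$; $N(H)/H$ acts on $V^H$. For a positive divisor $d_0$ of $d$, $\mathcal{P}_n^{(d_0)}\subset GL((\mathbb{C}^{d_0})^{\otimes n})$ is the $n$-qudit Pauli group defined in the same way for qudits of dimension $d_0$ (with the primitive $d_0$-th root of unity $\xi^{d/d_0}$ in place of $\xi$), and $\mathcal{P}_n^{(d_0,\zeta)}$ is the subgroup of $GL((\mathbb{C}^{d_0})^{\otimes n})$ generated by $\mathcal{P}_n^{(d_0)}$ and by the operator of multiplication by $\zeta$ (the fixed primitive $\bar d$-th root of unity). For groups $G_1,G_2$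 each containing a distinguished central element of order $\bar d$ denoted $\zeta$, $G_1\times_\zeta G_2$ is the direct product $G_1\times G_2$ modulo the relation identifying the element $\zeta$ of $G_1$ with the element $\zeta$ of $G_2$. The group $\mathcal{P}_1^{(d_1,\zeta)}\times_\zeta\cdots\times_\zeta\mathcal{P}_1^{(d_k,\zeta)}$ acts on $\mathbb{C}^{d_1}\otimes\cdots\otimes\mathbb{C}^{d_k}$ factorwise. An empty product ($k=0$) means the group generated by $\zeta$ acting on $\mathbb{C}$ by scalars. *)

(* Defs.v *)
From HB Require Import structures.
From mathcomp Require Import all_boot all_order all_algebra.
From mathcomp Require Import boolp classical_sets functions reals.
From mathcomp Require Import complex.

Set Implicit Arguments.
Unset Strict Implicit.
Unset Printing Implicit Defensive.

Import Order.TTheory GRing.Theory Num.Theory.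

Local Open Scope classical_set_scope.
Local Open Scope ring_scope.

Section SetGroups.
Context {G : groupType}.
Implicit Types (A B H N S : set G) (g : G).

Definition subgroup H :=
  [/\ H 1%g, (forall x y, H x -> H y -> H (x * y)%g)
    & (forall x, H x -> H (x^-1)%g)].

Definition subgroup_gen S : set G := smallest subgroup S.

Lemma subgroup_gen_subgroup S : subgroup (subgroup_gen S).
Proof.
split=> [M [[]] //|x y Hx Hy M SM|x Hx M SM]; case: (SM) => [[_ MM MV] _].
  by apply: MM; [apply: Hx | apply: Hy].
by apply: MV; apply: Hx.
Qed.

Lemma sub_subgroup_gen S : S `<=` subgroup_gen S.
Proof. exact: sub_gen_smallest. Qed.

Lemma subgroup_gen_min S H : subgroup H -> S `<=` H -> subgroup_gen S `<=` H.
Proof. exact: smallest_sub. Qed.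

Definition commutative_set H := forall x y, H x -> H y -> (x * y = y * x)%g.

Definition normaliser_in N H : set G :=
  [set g | N g /\ [set (h ^ g)%g | h in H] = H].

Definition setmulg A B : set G := [set (a * b)%g | a in A & b in B].

Definition left_coset g H : set G := [set (g * h)%g | h in H].

Definition coset_quotient N H : set (set G) := [set left_coset g H | g in N].

End SetGroups.

(* For a subgroup H normal in N, coset_quotient N H with the product setmulg is
   the group N / H. *)
Definition quotient_iso (G G' : groupType) (N H : set G) (N' H' : set G')
    (phi : set G -> set G') :=
  set_bij (coset_quotient N H) (coset_quotient N' H') phi /\
  (forall A B, coset_quotient N H A -> coset_quotient N H B ->
     phi (setmulg A B) = setmulg (phi A) (phi B)).

Section DirectProduct.
Context {I : finType} {G : I -> groupType}.
Implicit Types f g h : {dffun forall i, G i}.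

Definition dffun_mulg f g : {dffun forall i, G i} :=
  [ffun i => (f i * g i)%g].
Definition dffun_oneg : {dffun forall i, G i} := [ffun i => 1%g].
Definition dffun_invg f : {dffun forall i, G i} := [ffun i => (f i)^-1%g].

Lemma dffun_mulgA : associative dffun_mulg.
Proof. by move=> f g h; apply/ffunP=> i; rewrite !ffunE mulgA. Qed.
Lemma dffun_mul1g : left_id dffun_oneg dffun_mulg.
Proof. by move=> f; apply/ffunP=> i; rewrite !ffunE mul1g. Qed.
Lemma dffun_mulg1 : right_id dffun_oneg dffun_mulg.
Proof. by move=> f; apply/ffunP=> i; rewrite !ffunE mulg1. Qed.
Lemma dffun_mulVg : left_inverse dffun_oneg dffun_invg dffun_mulg.
Proof. by move=> f; apply/ffunP=> i; rewrite !ffunE mulVg. Qed.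
Lemma dffun_mulgV : right_inverse dffun_oneg dffun_invg dffun_mulg.
Proof. by move=> f; apply/ffunP=> i; rewrite !ffunE mulgV. Qed.

HB.instance Definition _ := isGroup.Build {dffun forall i, G i}
  dffun_mulgA dffun_mul1g dffun_mulg1 dffun_mulVg dffun_mulgV.

End DirectProduct.

Section GeneralLinear.
Context {K : fieldType} {V : vectType K}.

Record GL := MkGL { gl_val :> 'End(V); gl_inj : lker gl_val == 0%VS }.

HB.instance Definition _ := [isSub for gl_val].
HB.instance Definition _ := [Choice of GL by <:].

Implicit Types f g h : GL.

Lemma gl_mul_inj f g : lker (f \o g)%VF == 0%VS.
Proof.
apply/lker0P => x y; rewrite !lfunE /= => /(lker0P (gl_inj f)).
exact: (lker0P (gl_inj g)).
Qed.

Lemma gl_one_inj : lker (\1%VF : 'End(V)) == 0%VS.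
Proof. by apply/lker0P => x y; rewrite !lfunE. Qed.

Lemma gl_inv_inj f : lker (f^-1)%VF == 0%VS.
Proof.
apply/lker0P => x y /(congr1 f).
by rewrite -!comp_lfunE lker0_compfV ?gl_inj // !lfunE.
Qed.

Definition gl_mul f g := MkGL (gl_mul_inj f g).
Definition gl_one := MkGL gl_one_inj.
Definition gl_inv f := MkGL (gl_inv_inj f).

Lemma gl_mulA : associative gl_mul.
Proof. by move=> f g h; apply: val_inj; rewrite /= comp_lfunA. Qed.
Lemma gl_mul1g : left_id gl_one gl_mul.
Proof. by move=> f; apply: val_inj; rewrite /= comp_lfun1l. Qed.
Lemma gl_mulg1 : right_id gl_one gl_mul.
Proof. by move=> f; apply: val_inj; rewrite /= comp_lfun1r. Qed.
Lemma gl_mulVg : left_inverse gl_one gl_inv gl_mul.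
Proof. by move=> f; apply: val_inj; rewrite /= lker0_compVf ?gl_inj. Qed.
Lemma gl_mulgV : right_inverse gl_one gl_inv gl_mul.
Proof. by move=> f; apply: val_inj; rewrite /= lker0_compfV ?gl_inj. Qed.

HB.instance Definition _ :=
  isGroup.Build GL gl_mulA gl_mul1g gl_mulg1 gl_mulVg gl_mulgV.

Definition scalar_op (c : K) : 'End(V) := c *: \1%VF.

Definition fixed_by (H : set GL) : set V :=
  [set v | forall h, H h -> h v = v].

End GeneralLinear.

Arguments GL {K} V.

(* C^T with its standard orthonormal basis indexed by the finite type T. *)
Notation hilb C T := {ffun T -> C^o}.

(* C^(e_1) (x) ... (x) C^(e_k) is C^T with T the set of multi-indices. *)
Definition multi_index {k : nat} (e : 'I_k -> nat) : finType :=
  {dffun forall i : 'I_k, 'I_(e i)}.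

(* (C^d)^(x)n *)
Notation qudits C n d := (hilb C (multi_index (fun _ : 'I_n => d))).

Section Hilbert.
Context {C : numClosedFieldType}.

Definition inner {T : finType} (x y : hilb C T) : C :=
  \sum_t x t * (y t)^*.

Definition basis_vec {T : finType} (t : T) : hilb C T :=
  [ffun s => (s == t)%:R].

Definition unitary_onto {T T' : finType}
    (U : 'Hom(hilb C T, hilb C T')) (E : set (hilb C T')) :=
  (forall x y, inner (U x) (U y) = inner x y) /\ range U = E.

Section MatrixOperator.
Context {T : finType}.

Definition op_mx_fun (A : T -> T -> C) (x : hilb C T) : hilb C T :=
  [ffun t => \sum_s A t s * x s].

Lemma op_mx_fun_linear A : linear (op_mx_fun A).
Proof.
move=> a x y; apply/ffunP => t; rewrite !ffunE scaler_sumr -big_split /=.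
by apply: eq_bigr => s _; rewrite !ffunE mulrDr /= /GRing.scale /= mulrCA.
Qed.

HB.instance Definition _ A :=
  GRing.isLinear.Build C (hilb C T) (hilb C T) _ (op_mx_fun A)
    (op_mx_fun_linear A).

Definition op_mx (A : T -> T -> C) : 'End(hilb C T) := linfun (op_mx_fun A).

Lemma op_mxE A x t : op_mx A x t = \sum_s A t s * x s.
Proof. by rewrite lfunE /= ffunE. Qed.

Lemma op_mx_basis A s t : op_mx A (basis_vec s) t = A t s.
Proof.
rewrite op_mxE (bigD1 s) //= ffunE eqxx mulr1 big1 ?addr0 // => i /negPf ne_is.
by rewrite ffunE ne_is mulr0.
Qed.

End MatrixOperator.

Section Tensor.
Context {k : nat} (e : 'I_k -> nat).

Definition tensor_vec (x : forall i, hilb C 'I_(e i)) :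
    hilb C (multi_index e) :=
  [ffun t : multi_index e => \prod_i x i (t i)].

Definition tensor_op (A : forall i, 'End(hilb C 'I_(e i))) :
    'End(hilb C (multi_index e)) :=
  op_mx (fun t s : multi_index e => \prod_i A i (basis_vec (s i)) (t i)).

Lemma tensor_basis (s : multi_index e) :
  tensor_vec (fun i => basis_vec (s i)) = basis_vec s.
Proof.
apply/ffunP => t; rewrite !ffunE; case: eqP => [-> | /eqP ne_ts].
  by rewrite big1 // => i _; rewrite ffunE eqxx.
have /existsP [i ne_i] : [exists i, t i != s i].
  rewrite -negb_forall; apply: contra ne_ts => /forallP eq_ts.
  by apply/eqP/ffunP => i; apply/eqP.
by rewrite (bigD1 i) //= ffunE (negPf ne_i) mul0r.
Qed.

Lemma tensor_op_basis A (s : multi_index e) :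
  tensor_op A (basis_vec s) = tensor_vec (fun i => A i (basis_vec (s i))).
Proof. by apply/ffunP => t; rewrite op_mx_basis ffunE. Qed.

End Tensor.

Section Qudit.
Variable d : nat.

Definition shift_op : 'End(hilb C 'I_d) :=
  op_mx (fun j i : 'I_d => (j == ordS i)%:R).

Definition clock_op (xi : C) : 'End(hilb C 'I_d) :=
  op_mx (fun j i : 'I_d => (j == i)%:R * xi ^+ i).

Lemma shift_op_basis i : shift_op (basis_vec i) = basis_vec (ordS i).
Proof. by apply/ffunP => j; rewrite op_mx_basis ffunE. Qed.

Lemma clock_op_basis xi i :
  clock_op xi (basis_vec i) = xi ^+ i *: basis_vec i.
Proof. by apply/ffunP => j; rewrite op_mx_basis !ffunE mulrC. Qed.

End Qudit.
End Hilbert.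

Unset Implicit Arguments.

Section Pauli.
Context {C : numClosedFieldType}.

Definition dbar (d : nat) : nat := if odd d then d else (2 * d)%N.

Definition local_op {n d : nat} (r : 'I_n) (A : 'End(hilb C 'I_d)) :
    'End(qudits C n d) :=
  tensor_op (fun i : 'I_n => if i == r then A else \1%VF).

Definition pauli (n d : nat) (zeta : C) : set (GL (qudits C n d)) :=
  subgroup_gen [set g |
    [\/ exists r, gl_val g = local_op r (shift_op d),
        exists r, gl_val g = local_op r (clock_op d (zeta ^+ 2))
      | gl_val g = scalar_op zeta]].

(* The case n = 1, acting on C^d itself instead of the one-factor tensor
   product. *)
Definition pauli1 (d : nat) (zeta : C) : set (GL (hilb C 'I_d)) :=
  subgroup_gen [set g | [\/ gl_val g = shift_op d,
                         gl_val g = clock_op d (zeta ^+ 2)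
                       | gl_val g = scalar_op zeta]].

(* For d0 dividing d and zeta a primitive (dbar d)-th root of unity, a primitive
   (dbar d0)-th root of unity whose square is xi ^+ (d %/ d0), xi = zeta ^+ 2.
   It is the only one if d0 is odd; if d0 is even the only other one is its
   opposite, which is one of its powers. *)
Definition divisor_root (d d0 : nat) (zeta : C) : C :=
  if odd d0 then zeta ^+ (d %/ d0 * d0.+1) else zeta ^+ (d %/ d0).

Lemma divisor_root_sqr d d0 zeta : (d0 %| d)%N -> zeta ^+ (2 * d) = 1 ->
  divisor_root d d0 zeta ^+ 2 = (zeta ^+ 2) ^+ (d %/ d0).
Proof.
move=> d0_d zd; rewrite /divisor_root; case: odd; rewrite -!exprM; last first.
  by rewrite mulnC.
by rewrite [(_ * 2)%N]mulnC mulnS divnK // mulnDr exprD zd mulr1.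
Qed.

Lemma divisor_root_prim d d0 zeta : (0 < d)%N -> (d0 %| d)%N ->
  (dbar d).-primitive_root zeta ->
  (dbar d0).-primitive_root (divisor_root d d0 zeta).
Proof.
move=> d_gt0 d0_d prim; rewrite /divisor_root.
set m := (d %/ d0)%N; have dE : d = (m * d0)%N by rewrite divnK.
have m_gt0 : (0 < m)%N by move: d_gt0; rewrite dE muln_gt0 => /andP[].
have gcd_odd : gcdn d0.+1 d0 = 1%N by apply/eqP/coprimeSn.
have powP r k :
    (dbar d = gcdn k (dbar d) * r)%N -> r.-primitive_root (zeta ^+ k).
  move=> nE; have := exp_prim_root prim k; rewrite {1}nE mulKn //.
  by rewrite gcdn_gt0 (prim_order_gt0 prim) orbT.
case: ifP => odd_d0; apply: powP;
    rewrite /dbar odd_d0 dE oddM odd_d0 ?andbF ?andbT.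
  case: ifP => _; first by rewrite -muln_gcdr gcd_odd muln1.
  have hE : (d0.+1 = 2 * uphalf d0)%N.
    by rewrite mul2n uphalfE -[LHS]odd_double_half /= odd_d0.
  rewrite hE mulnCA -!muln_gcdr.
  suff -> : gcdn (uphalf d0) d0 = 1%N by rewrite muln1 mulnA.
  by apply/eqP; apply: coprime_dvdl (coprimeSn d0); rewrite hE dvdn_mull.
by rewrite mulnCA -{2}[m]muln1 -muln_gcdr gcd1n muln1.
Qed.

(* pauli1_ext d d0 zeta is the one-qudit Pauli group for qudits of dimension d0,
   enlarged by the scalar zeta. *)
Definition pauli1_ext (d d0 : nat) (zeta : C) : set (GL (hilb C 'I_d0)) :=
  subgroup_gen (pauli1 d0 (divisor_root d d0 zeta) `|`
             [set g | gl_val g = scalar_op zeta]).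

Lemma pauli1_ext1 d zeta : zeta ^+ (2 * d) = 1 ->
  pauli1_ext d 1 zeta =
  subgroup_gen [set g : GL (hilb C 'I_1) | gl_val g = scalar_op zeta].
Proof.
move=> zd; have vec1 (x y : hilb C 'I_1) : x 0 = y 0 -> x = y.
  by move=> xy; apply/ffunP => i; rewrite !ord1.
set S := [set _ | _]; have sgS := subgroup_gen_subgroup S.
have one_in (g : GL (hilb C 'I_1)) : gl_val g = \1%VF -> subgroup_gen S g.
  move=> g1; have -> : g = 1%g by apply: val_inj.
  by case: sgS.
apply/seteqP; split;
  (apply: subgroup_gen_min; first exact: subgroup_gen_subgroup) => g;
  last by move=> Sg; apply: sub_subgroup_gen; right.
case=> [|Sg]; last exact: sub_subgroup_gen.
apply: subgroup_gen_min g => // g [gE|gE|gE]; apply: one_in; rewrite gE;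
  apply/lfunP => x; apply: vec1; rewrite ?op_mxE ?big_ord1 ?lfunE /=.
- by rewrite mul1r.
- by rewrite expr0 !mul1r.
rewrite ffunE lfunE /= /divisor_root /= divn1 mulnC zd.
by rewrite /GRing.scale /= mul1r.
Qed.

Section CentralProduct.
Context {k : nat} (e : 'I_k -> nat) (d : nat) (zeta : C).

Definition pauli_factors : set {dffun forall i, GL (hilb C 'I_(e i))} :=
  [set h | forall i : 'I_k, pauli1_ext d (e i) zeta (h i)].

(* The central product is coset_quotient pauli_factors zeta_relations: the
   relations identify the copies of zeta in any two factors. *)
Definition zeta_relations : set {dffun forall i, GL (hilb C 'I_(e i))} :=
  subgroup_gen [set h : {dffun forall i, GL (hilb C 'I_(e i))} | exists i j,
    [/\ i != j, gl_val (h i) = scalar_op zeta,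
        gl_val (h j) = scalar_op zeta^-1
      & forall l, l != i -> l != j -> h l = 1%g]].

End CentralProduct.
End Pauli.

Definition dims_of (s : seq nat) (i : 'I_(size s)) : nat := nth 1%N s i.

(* By convention the central product of no factors is the group subgroup_gen by
   zeta acting on C, which is the one-qudit group for qudits of dimension 1
   (pauli1_ext1). *)
Definition factor_dims (s : seq nat) : seq nat :=
  if s is [::] then [:: 1%N] else s.

(* Main.v *)
(* The normaliser N of H is its centraliser in the Pauli group, because
   commutators are powers of xi and H contains no scalar but 1.  Every
   non-scalar Pauli operator has trace zero; hence V^H is nonzero, an element
   of N acting trivially on V^H lies in H, and, by irreducibility of the Pauli
   group, V^H is irreducible under N, so that by Schur's lemma the centre of N
   is generated by zeta and H.  Splitting off from N, one after the other, pairs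
   (x_i, z_i) whose commutator xi ^ (d / d_i) has the least possible exponent
   exhausts N modulo its centre; up to powers of zeta, x_i ^ d_i and z_i ^ d_i
   lie in H.  A unit vector w of V^H fixed by all the z_i exists, since the x_i
   permute the eigenspaces of the z_i, and the vectors prod_i x_i ^ t_i w form
   an orthonormal basis of V^H on which the x_i and z_i act as the shift and
   clock operators of C^d_1 (x) ... (x) C^d_k. *)

Require Import Defs.
From HB Require Import structures.
From mathcomp Require Import all_boot all_order all_algebra.
From mathcomp Require Import boolp classical_sets functions reals.
From mathcomp Require Import complex zify.

Set Implicit Arguments.
Unset Strict Implicit.
Unset Printing Implicit Defensive.

Import Order.TTheory GRing.Theory Num.Theory.

Local Open Scope classical_set_scope.

(** * Groups with scalar commutators *)

(** Commutator exponents live in Z/d, where a nonzero exponent need not be invertible, so symplectic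
    Gram-Schmidt splits off a pair only if its exponent divides all those it has to cancel; this is
    what the least exponent provides. Next, [x_i ^ d_i] is at first only a power of zeta times an
    element of [H]. Rescaling [x_i] removes that power because the exponent of the Pauli group
    equals the order of zeta, which the doubling in [dbar] ensures for even [d]. Irreducibility
    serves twice, each time in the form that a vector of V^H orthogonal to the [N]-orbit of a
    nonzero vector of V^H is zero: for the centre of [N], and to see without a dimension count that
    the orthonormal vectors span V^H. The isomorphism of groups is not defined on generators:
    elements of the two groups are related when they induce the same operator on V^H, and the
    relation descends to a bijection of cosets because [H] and the zeta relations are exactly the
    elements acting trivially. Exponents are natural numbers throughout; a negative one is a
    multiple of [d.-1] or [D.-1]. *)

Section SubgroupTheory.
Variable G : groupType.
Implicit Types (A S : set G) (x g h : G).

Lemma subgroup1 A : subgroup A -> A 1%g. Proof. by case. Qed.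

Lemma subgroupM A g h : subgroup A -> A g -> A h -> A (g * h)%g.
Proof. by case=> _ AM _; apply: AM. Qed.

Lemma subgroupV A g : subgroup A -> A g -> A g^-1%g.
Proof. by case=> _ _ AV; apply: AV. Qed.

Lemma subgroupX A g m : subgroup A -> A g -> A (g ^+ m)%g.
Proof.
move=> sA Ag; elim: m => [|m IHm]; first exact: subgroup1.
by rewrite expgS; apply: subgroupM.
Qed.

Lemma subgroup_commute S : subgroup [set g | forall h, S h -> commute g h].
Proof.
split=> [h _|g g' cg cg' h Sh|g cg h Sh] /=; apply: commute_sym.
- exact: commute1.
- by apply: commuteM; apply: commute_sym; [apply: cg | apply: cg'].
- by apply: commuteV; apply: commute_sym; apply: cg.
Qed.

Lemma subgroupI A B : subgroup A -> subgroup B -> subgroup (A `&` B).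
Proof.
move=> sA sB; split; first by split; apply: subgroup1.
- by move=> g h [Ag Bg] [Ah Bh]; split; apply: subgroupM.
- by move=> g [Ag Bg]; split; apply: subgroupV.
Qed.

End SubgroupTheory.

Section ScalarCommutators.
Variables (G : groupType) (xi : G) (d D : nat).
Hypotheses (xi_central : forall g, commute xi g) (xi_d : (xi ^+ d = 1)%g).
Implicit Types (g h x y z : G) (A S : set G).

(** A relation rather than a function, since the exponent is only determined modulo the order of
    [xi]. *)
Definition comm_exp g h i := (g * h = xi ^+ i * (h * g))%g.

Let xiC i g : commute (xi ^+ i)%g g.
Proof. by apply/commute_sym/commuteX/commute_sym/xi_central. Qed.

Lemma comm_exp0 g h : comm_exp g h 0 <-> commute g h.
Proof. by rewrite /comm_exp expg0 mul1g. Qed.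

Lemma comm_expMr g h h' i j :
  comm_exp g h i -> comm_exp g h' j -> comm_exp g (h * h')%g (i + j)%N.
Proof.
rewrite /comm_exp => gh gh'; rewrite mulgA gh -mulgA -[(h * g * h')%g]mulgA gh'.
by rewrite [(h * (xi ^+ j * _))%g]mulgA -(xiC j h) expgnDr !mulgA.
Qed.

Lemma comm_exp_sym g h i : (0 < d)%N -> comm_exp g h i ->
  comm_exp h g (i * d.-1)%N.
Proof.
rewrite /comm_exp => d_gt0 ->; rewrite mulgA -expgnDr -mulnSr prednK //.
by rewrite mulnC expgnA xi_d expg1n mul1g.
Qed.

Lemma comm_expXr g h i m : comm_exp g h i -> comm_exp g (h ^+ m)%g (m * i)%N.
Proof.
move=> gh; elim: m => [|m IHm]; first exact/comm_exp0/commute1.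
by rewrite expgS mulSn; apply: comm_expMr.
Qed.

Lemma comm_exp_prod (I : Type) (r : seq I) (F : I -> G) (a : I -> nat) g :
  (forall j, comm_exp g (F j) (a j)) ->
  comm_exp g (\prod_(j <- r) F j)%g (\sum_(j <- r) a j)%N.
Proof.
move=> gF; elim: r => [|j r IHr]; rewrite !(big_nil, big_cons).
  exact/comm_exp0/commute1.
exact: comm_expMr.
Qed.

Lemma comm_exp_eq g h i j :
  (xi ^+ i = xi ^+ j)%g -> comm_exp g h i -> comm_exp g h j.
Proof. by rewrite /comm_exp => <-. Qed.

Lemma comm_exp_mod g h i : comm_exp g h (i %% d) <-> comm_exp g h i.
Proof.
have E : (xi ^+ i = xi ^+ (i %% d))%g.
  by rewrite {1}(divn_eq i d) expgnDr mulnC expgnA xi_d expg1n mul1g.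
by split; apply: comm_exp_eq.
Qed.

Lemma comm_expMl g g' h i j :
  comm_exp g h i -> comm_exp g' h j -> comm_exp (g * g')%g h (i + j)%N.
Proof.
rewrite /comm_exp => gh gh'.
rewrite -mulgA gh' mulgA -(xiC j g) -!mulgA [(g * (h * _))%g]mulgA gh.
by rewrite addnC expgnDr !mulgA.
Qed.

Lemma comm_expV g h i : (0 < d)%N ->
  comm_exp g h i -> comm_exp g h^-1%g (i * d.-1)%N.
Proof.
rewrite /comm_exp => d_gt0 gh; apply: (mulIg h); apply: (mulgI h).
rewrite mulgVK -mulgA [RHS]mulgA -(xiC _ h) -!mulgA mulVKg gh mulgA -expgnDr.
by rewrite -mulnSr prednK // mulnC expgnA xi_d expg1n mul1g.
Qed.

(** Closure under products and inverses is proved in the second argument only; [comm_exp_sym]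
    transfers it to the first. *)
Lemma comm_exp_gen S :
  (0 < d)%N -> (forall g h, S g -> S h -> exists i, comm_exp g h i) ->
  forall g h, subgroup_gen S g -> subgroup_gen S h -> exists i, comm_exp g h i.
Proof.
move=> d_gt0 SS.
have genr g : (forall h, S h -> exists i, comm_exp g h i) ->
    forall h, subgroup_gen S h -> exists i, comm_exp g h i.
  move=> gS; apply: (@subgroup_gen_min _ _ [set h | exists i, comm_exp g h i]).
    split=> [|h h' [i gh] [j gh']|h [i gh]] /=.
    - by exists 0%N; apply/comm_exp0/commute1.
    - by exists (i + j)%N; apply: comm_expMr.
    - by exists (i * d.-1)%N; apply: comm_expV.
  exact: gS.
move=> g h Sg; apply: (genr) => h' Sh'.
have [|i hg] := genr h' _ g Sg; first by move=> *; apply: SS.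
by exists (i * d.-1)%N; apply: comm_exp_sym.
Qed.

(** Sorting the word moves each [h] past every later [g], one exchange for each of the ['C(m, 2)]
    pairs of positions. *)
Lemma expgM_comm g h i m : comm_exp h g i ->
  ((g * h) ^+ m = xi ^+ (i * 'C(m, 2)) * (g ^+ m * h ^+ m))%g.
Proof.
move=> hg; have E k : (h ^+ k * g = xi ^+ (i * k) * (g * h ^+ k))%g.
  elim: k => [|k IHk]; first by rewrite muln0 !expg0 !mul1g mulg1.
  rewrite expgS -mulgA IHk mulgA -(xiC _ h) -mulgA [(h * (g * _))%g]mulgA hg.
  by rewrite mulnS addnC expgnDr !mulgA.
elim: m => [|m IHm]; first by rewrite muln0 !expg0 !mulg1.
rewrite expgSr IHm binS bin1 mulnDr expgnDr -!mulgA; congr (_ * _)%g.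
rewrite [(h ^+ m * _)%g]mulgA E -!mulgA [LHS]mulgA -(xiC _ (g ^+ m)%g) -!mulgA.
by congr (_ * _)%g; rewrite mulgA -expgSr -expgSr.
Qed.

(** The binomial condition makes the solutions of [g ^+ D = 1] stable under products. For [xi] of
    even order [d] it fails with [D = d] and holds with [D = 2 * d]. *)
Lemma exponent_gen S : (0 < d)%N ->
  (forall g h, S g -> S h -> exists i, comm_exp g h i) ->
  (xi ^+ 'C(D, 2) = 1)%g -> (forall g, S g -> g ^+ D = 1)%g ->
  forall g, subgroup_gen S g -> (g ^+ D = 1)%g.
Proof.
move=> d_gt0 SS xiD SD g Sg; have sgS := subgroup_gen_subgroup S.
suff: (subgroup_gen S `&` [set g | g ^+ D = 1])%g g by case.
apply: subgroup_gen_min Sg => [|h Sh].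
  split.
  - by split; [exact: subgroup1 sgS | rewrite /= expg1n].
  - move=> h h' [Sh hD] [Sh' h'D]; split; first exact: subgroupM sgS _ _.
    have [i hh'] := comm_exp_gen d_gt0 SS Sh' Sh.
    by rewrite /= (expgM_comm _ hh') hD h'D !mulg1 mulnC expgnA xiD expg1n.
  - move=> h [Sh hD]; split; first exact: subgroupV sgS _.
    by rewrite /= expVgn hD invg1.
by split; [apply: sub_subgroup_gen | apply: SD].
Qed.

End ScalarCommutators.

(** * Splitting a group with scalar commutators into hyperbolic pairs *)

Section HyperbolicPairs.
Variables (G : groupType) (zt : G) (d D : nat) (H : set G).
Let xi := (zt ^+ 2)%g.
Hypotheses (d_gt0 : (0 < d)%N) (D_gt0 : (0 < D)%N) (d_dvd_D : (d %| D)%N).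
Hypothesis zt_central : forall g, commute zt g.
Hypothesis zt_order : forall i, (zt ^+ i = 1)%g <-> (D %| i)%N.
Hypothesis xi_order : forall i, (xi ^+ i = 1)%g <-> (d %| i)%N.
Hypotheses (sgH : subgroup H) (H_zt : forall i, H (zt ^+ i)%g -> (zt ^+ i = 1)%g).
Implicit Types (g h x y z : G) (A S : set G) (t u : nat * G * G).

Let xi_central g : commute xi g.
Proof. exact/commute_sym/commuteX/commute_sym. Qed.

Let xi_d : (xi ^+ d = 1)%g. Proof. exact/xi_order. Qed.

(** Raising [g ^+ m = zt ^+ i * h] to the power [D / m] puts [zt ^+ (i * (D / m))] in [H], so it is
    [1]. Hence [m] divides [i], and multiplying [g] by the inverse of [zt ^+ (i / m)] removes the
    scalar. *)
Lemma rescale_into g m i h : (m %| D)%N -> (g ^+ D = 1)%g -> H h ->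
  (g ^+ m = zt ^+ i * h)%g -> exists j, H ((zt ^+ j * g) ^+ m)%g.
Proof.
move=> /dvdnP[q DE] gD Hh gm.
have ztC j g' : commute (zt ^+ j)%g g' by apply/commute_sym/commuteX/commute_sym.
have ztq : (zt ^+ (i * q) = 1)%g.
  apply: H_zt; rewrite -[(zt ^+ _)%g]invgK; apply: subgroupV => //.
  suff -> : ((zt ^+ (i * q))^-1 = h ^+ q)%g by apply: subgroupX.
  by apply: mulg1_eq; rewrite expgnA -(expgMn q (ztC i h)) -gm -expgnA mulnC -DE.
have /dvdnP[j iE] : (m %| i)%N.
  move/zt_order: ztq; rewrite DE mulnC dvdn_pmul2r //.
  by move: D_gt0; rewrite DE muln_gt0 => /andP[].
exists (j * D.-1)%N; rewrite expgMn ?ztC // gm -expgnA mulgA -expgnDr.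
rewrite mulnAC -iE -mulnSr prednK //.
suff -> : (zt ^+ (i * D) = 1)%g by rewrite mul1g.
exact/zt_order/dvdn_mull.
Qed.

(** For [t = (d1, x, z)]: modulo [H], [x] and [z] satisfy the relations of the shift and the clock
    of a qudit of dimension [d1]. *)
Definition hyperbolic_pair A t :=
  [/\ (t.1.1 %| d)%N, A t.1.2 /\ A t.2, H (t.1.2 ^+ t.1.1)%g, H (t.2 ^+ t.1.1)%g
    & comm_exp xi t.2 t.1.2 (d %/ t.1.1)].

Definition orthogonal_pairs t u :=
  [/\ commute t.1.2 u.1.2, commute t.1.2 u.2, commute t.2 u.1.2
    & commute t.2 u.2].

Lemma orthogonal_pairs_sym t u : orthogonal_pairs t u -> orthogonal_pairs u t.
Proof. by case=> *; split; apply: commute_sym. Qed.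

(** Besides being the default of [nth], this is the trivial pair of dimension 1 that ends the
    recursion, so that the list of pairs is never empty. *)
Let t0 : nat * G * G := (1%N, 1%g, 1%g).

(* The first pair realises the least positive commutator exponent; minimality
   forces all commutators with its two members to be multiples of it, so that
   the pair splits off. *)
Lemma hyperbolic_pairs (s : seq G) A :
  subgroup A -> (forall g, A g -> g \in s) -> A zt -> H `<=` A ->
  (forall g h, A g -> A h -> exists i, comm_exp xi g h i) ->
  (forall g, A g -> (g ^+ D = 1)%g) -> (forall g h, H g -> A h -> commute g h) ->
  (forall g, A g -> (forall h, A h -> commute g h) ->
     exists i h, H h /\ (g = zt ^+ i * h)%g) ->
  exists ts : seq (nat * G * G),
    [/\ ts != [::], forall t, t \in ts -> hyperbolic_pair A t,
        forall i j, (i < size ts)%N -> (j < size ts)%N -> i != j ->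
          orthogonal_pairs (nth t0 ts i) (nth t0 ts j)
      & forall S, subgroup S -> S zt -> H `<=` S ->
          (forall t, t \in ts -> S t.1.2 /\ S t.2) -> A `<=` S].
Proof.
(* The list [s] containing [A] measures the induction: each split removes [z] from it. *)
have [m] := ubnP (size s); elim: m => // m IHm in s A * => /ltnSE le_s_m.
move=> sgA A_s Azt HA Acomm AD HAC AZ.
have exE : exists i,
    `[< (0 < i)%N /\ exists x y, [/\ A x, A y & comm_exp xi x y i] >].
  (* The exponent [d] is always attained, since [xi ^+ d = 1]. The minimum [i0] equals [d] exactly
     when [A] is commutative. *)
  exists d; apply/asboolP; split=> //; exists 1%g, 1%g.
  by split; [exact: subgroup1 | exact: subgroup1 | rewrite /comm_exp xi_d !mul1g].
case: (ex_minnP exE) => i0 /asboolP[i0_gt0 [z [x [Az Ax zx]]]] i0_min.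
have i0_le a b i : A a -> A b -> comm_exp xi a b i -> (0 < i)%N -> (i0 <= i)%N.
  by move=> Aa Ab ab i_gt0; apply: i0_min; apply/asboolP; split=> //; exists a, b.
(* Euclidean division: [b] has exponent [-i0] against [a], so [b ^+ (i %/ i0) * g] has exponent
   [i %% i0], which minimality forces to be zero. *)
have min_dvd a b : A a -> A b -> comm_exp xi a b (i0 * d.-1)%N ->
    forall g i, A g -> comm_exp xi a g i -> (i0 %| i)%N.
  move=> Aa Ab ab g i Ag ag; rewrite /dvdn eqn0Ngt; apply/negP => r_gt0.
  have := i0_le a (b ^+ (i %/ i0) * g)%g (i %% i0)%N Aa _ _ r_gt0.
  rewrite leqNgt ltn_mod i0_gt0 => /(_ _ _)/negP[] //.
    by apply: subgroupM => //; apply: subgroupX.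
  have abq := comm_expMr xi_central (comm_expXr xi_central (i %/ i0) ab) ag.
  apply: comm_exp_eq abq; rewrite {2}(divn_eq i i0) addnA mulnA -mulnSr prednK //.
  by rewrite expgnDr mulnC expgnA xi_d expg1n mul1g.
have dvd_xz y w : A y -> A w -> comm_exp xi w y i0 ->
    (forall g i, A g -> comm_exp xi y g i -> (i0 %| i)%N) /\
    (forall g i, A g -> comm_exp xi w g i -> (i0 %| i)%N).
  move=> Ay Aw wy; split.
    exact: min_dvd Ay Aw (comm_exp_sym xi_d d_gt0 wy).
  apply: (min_dvd w (y ^+ d.-1)%g) => //; first exact: subgroupX.
  by rewrite mulnC; apply: comm_expXr.
have [dvd_x dvd_z] := dvd_xz x z Ax Az zx.
(* The trivial commutator of [z] with [1] also has exponent [d], which [i0] must divide. *)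
have i0_d : (i0 %| d)%N.
  apply: (dvd_z 1%g); first exact: subgroup1.
  by rewrite /comm_exp xi_d !mul1g mulg1.
have comm_dvd i g h : (d %| i)%N -> comm_exp xi g h i -> commute g h.
  by move=> /xi_order di; rewrite /comm_exp di mul1g.
case: (ltngtP i0 d) => [i0_lt|/ltn_geF|i0E]; last 2 first.
- by rewrite dvdn_leq.
- exists [:: t0]; split=> //.
  + move=> t; rewrite inE => /eqP->; split; rewrite /= ?dvd1n ?divn1 //.
    * by split; apply: subgroup1.
    * by rewrite expg1; apply: subgroup1.
    * by rewrite expg1; apply: subgroup1.
    * by rewrite /comm_exp xi_d !mul1g.
  + by move=> [|i] [|j].
  + move=> S sgS Szt HS _ g Ag.
    have [|i [h [Hh ->]]] := AZ g Ag.
      move=> h Ah; have [i /(comm_exp_mod xi_d) gh] := Acomm _ _ Ag Ah.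
      have [r0|r_gt0] := posnP (i %% d).
        by move: gh; rewrite r0 comm_exp0.
      by have := i0_le _ _ _ Ag Ah gh r_gt0; rewrite i0E leqNgt ltn_mod d_gt0.
    by apply: subgroupM (HS _ Hh) => //; apply: subgroupX.
set d1 := (d %/ i0)%N; have dE : d = (d1 * i0)%N by rewrite divnK.
have d1_gt0 : (0 < d1)%N by rewrite divn_gt0 // dvdn_leq.
have d1_d : (d1 %| d)%N by rewrite dE dvdn_mulr.
(* All exponents of [y] are multiples of [i0], and [d1 * i0 = d]. So [y ^+ d1] is central in [A], a
   power of [zt] times an element of [H]. *)
have rescale y : A y -> (forall g i, A g -> comm_exp xi y g i -> (i0 %| i)%N) ->
    exists j, H ((zt ^+ j * y) ^+ d1)%g.
  move=> Ay dvd_y; have Ayd := subgroupX d1 sgA Ay.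
  have [g Ag|i [h [Hh E]]] := AZ _ Ayd; last first.
    exact: rescale_into (dvdn_trans d1_d d_dvd_D) (AD _ Ay) Hh E.
  have [i yg] := Acomm _ _ Ay Ag; apply/commute_sym.
  have /dvdnP[q iE] := dvd_y _ _ Ag yg.
  have gy := comm_expXr xi_central d1 (comm_exp_sym xi_d d_gt0 yg).
  by apply: comm_dvd gy; rewrite iE dE -!mulnA mulnCA dvdn_mull // mulnA dvdn_mulr.
have [j Hx] := rescale _ Ax dvd_x; have [k Hz] := rescale _ Az dvd_z.
have Azt' i g : A g -> A (zt ^+ i * g)%g.
  by move=> Ag; apply: subgroupM => //; apply: subgroupX.
have {}zx : comm_exp xi (zt ^+ k * z)%g (zt ^+ j * x)%g i0.
  have ztC i g : commute g (zt ^+ i)%g by apply/commuteX/commute_sym/zt_central.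
  rewrite -[i0]add0n; apply: (comm_expMr xi_central); first exact/comm_exp0/ztC.
  rewrite -[i0]add0n; apply: (comm_expMl xi_central) => //.
  by apply/comm_exp0; apply: commute_sym; apply: ztC.
move: {dvd_x dvd_z} (Azt' j _ Ax) (Azt' k _ Az) Hx Hz zx.
move: {x z Ax Az} (zt ^+ j * x)%g (zt ^+ k * z)%g => x z Ax Az Hx Hz zx.
have [dvd_x dvd_z] := dvd_xz x z Ax Az zx.
pose B := A `&` [set g | forall h, [set x; z] h -> commute g h].
have sgB : subgroup B by apply: subgroupI sgA (subgroup_commute _).
have project g : A g -> exists y, [/\ A y, B (y * g)%g
    & forall S, subgroup S -> S x -> S z -> S y].
  move=> Ag; have [i xg] := Acomm _ _ Ax Ag; have [l zg] := Acomm _ _ Az Ag.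
  have /dvdnP[p iE] := dvd_x _ _ Ag xg; have /dvdnP[q lE] := dvd_z _ _ Ag zg.
  (* The exponents of [x] and [z] against [g] are [p * i0] and [q * i0]. The factor [z ^+ p] cancels
     the first and [x ^+ (- q)] the second, because [z] against [x] has exponent [i0]. *)
  exists (x ^+ (q * d.-1) * z ^+ p)%g; split=> //.
  - by apply: subgroupM => //; apply: subgroupX.
  - split; first by do 2?[apply: subgroupM => //]; apply: subgroupX.
    have xz := comm_exp_sym xi_d d_gt0 zx.
    have xx : comm_exp xi x x 0 by apply/comm_exp0.
    have zz : comm_exp xi z z 0 by apply/comm_exp0.
    move=> _ [] ->; apply/commute_sym.
      have := comm_expMr xi_central (comm_expMr xi_central
        (comm_expXr xi_central (q * d.-1) xx) (comm_expXr xi_central p xz)) xg.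
      apply: comm_dvd; rewrite iE muln0 add0n mulnA -mulnSr prednK //.
      exact: dvdn_mull.
    have := comm_expMr xi_central (comm_expMr xi_central
      (comm_expXr xi_central (q * d.-1) zx) (comm_expXr xi_central p zz)) zg.
    apply: comm_dvd; rewrite lE muln0 addn0 mulnAC -mulnSr prednK //.
    exact: dvdn_mull.
  - by move=> S sgS Sx Sz; apply: subgroupM => //; apply: subgroupX.
have zNB : ~ B z.
  case=> _ /(_ x (or_introl erefl)) czx.
  have : (xi ^+ i0 = 1)%g by apply: (mulIg (x * z)%g); rewrite mul1g -zx czx.
  by move/xi_order/dvdn_leq => /(_ i0_gt0); rewrite leqNgt i0_lt.
have [|//||||||||ts [ts0 tsP ts_orth tsB]] :=
  IHm [seq g <- s | g != z] B.
- rewrite size_filter; apply: leq_trans le_s_m.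
  rewrite -(count_predC (pred1 z) s) -[leqLHS]add1n leq_add2r.
  by rewrite -has_count has_pred1 A_s.
- move=> g Bg; rewrite mem_filter A_s ?andbT; last by case: Bg.
  by apply/eqP => gz; rewrite gz in Bg.
- by split=> // h _; apply: zt_central.
- by move=> h Hh; split; [apply: HA | move=> _ [] ->; apply: HAC].
- by move=> g h [Ag _] [Ah _]; apply: Acomm.
- by move=> g [Ag _]; apply: AD.
- by move=> g h Hg [Ah _]; apply: HAC.
(* The centre of [B] is central in [A]: each [h] in [A] is the product of [y^-1], where [y] is a
   word in [x] and [z], and an element of [B], and [g] commutes with both. *)
- move=> g [Ag cg] gB; apply: AZ => // h Ah; have [y [Ay Bh yS]] := project h Ah.
  have cgy : commute g y.
    apply/commute_sym; apply: (yS [set y | commute y g]).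
    - split=> [|a b ca cb|a ca] /=; apply: commute_sym.
      + exact: commute1.
      + by apply: commuteM; apply: commute_sym.
      + by apply: commuteV; apply: commute_sym.
    - by apply/commute_sym/cg; left.
    - by apply/commute_sym/cg; right.
  have := commuteM (commuteV cgy) (gB _ Bh).
  by rewrite mulKg.
exists ((d1, x, z) :: ts); split=> //.
- move=> t; rewrite inE => /orP[/eqP->|/tsP[? [[? _] [? _]] ? ? ?]]; last by split.
  by split=> //=; rewrite dE mulKn.
- have orth t : t \in ts -> orthogonal_pairs (d1, x, z) t.
    case/tsP=> _ [[_ c1] [_ c2]] _ _ _; split; apply/commute_sym.
    + by apply: c1; left.
    + by apply: c2; left.
    + by apply: c1; right.
    + by apply: c2; right.
  move=> [|i] [|l] //=; rewrite !ltnS.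
  + by move=> _ lt_l _; apply/orth/mem_nth.
  + by move=> lt_i _ _; apply/orthogonal_pairs_sym/orth/mem_nth.
  + exact: ts_orth.
- move=> S sgS Szt HS tsS g Ag.
  have [y [Ay Byg /(_ S sgS) Sy]] := project g Ag.
  have [Sx Sz] := tsS _ (mem_head _ _).
  rewrite -[g](mulKg y); apply: subgroupM => //.
    by apply: subgroupV => //; apply: Sy.
  by apply: tsB Byg => // t ts_t; apply: tsS; rewrite inE ts_t orbT.
Qed.

End HyperbolicPairs.

(** * Quotient isomorphisms from a relation between representatives *)

Section QuotientRelation.
Variables (G G' : groupType) (N H : set G) (P K : set G') (R : G -> G' -> Prop).
Hypotheses (sgN : subgroup N) (sgH : subgroup H) (sgP : subgroup P).
Hypotheses (sgK : subgroup K) (HN : H `<=` N) (KP : K `<=` P).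
Hypothesis R_l : forall g, N g -> exists2 h, P h & R g h.
Hypothesis R_r : forall h, P h -> exists2 g, N g & R g h.
Hypothesis RM : forall g g' h h', R g h -> R g' h' -> R (g * g')%g (h * h')%g.
Hypothesis RV : forall g h, R g h -> R g^-1%g h^-1%g.
Hypothesis R1 : forall g, N g -> (R g 1%g <-> H g).
Hypothesis R1' : forall h, P h -> (R 1%g h <-> K h).

(** [R] will be the relation of inducing the same operator. By [R1] and [R1'] it determines each
    side exactly up to [H] and [K], so the image of a coset is a single coset and no representative
    has to be chosen. *)
Definition rel_image (A : set G) : set G' :=
  [set h | P h /\ exists2 g, A g & R g h].

Lemma left_coset_eq (F : groupType) (A : set F) (g h : F) :
  subgroup A -> A (g^-1 * h)%g -> left_coset g A = left_coset h A.
Proof.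
move=> sgA gh; apply/seteqP; split=> _ [a Aa <-].
- exists ((g^-1 * h)^-1 * a)%g.
    by apply: subgroupM Aa => //; apply: subgroupV.
  by rewrite invgM invgK !mulgA mulgV mul1g.
- exists (g^-1 * h * a)%g; first exact: subgroupM.
  by rewrite !mulgA mulgV mul1g.
Qed.

Lemma setmulg_coset (F : groupType) (A : set F) (g h : F) : subgroup A ->
  (forall a, A a -> A (a ^ h)%g) ->
  setmulg (left_coset g A) (left_coset h A) = left_coset (g * h)%g A.
Proof.
move=> sgA Ah; apply/seteqP; split=> [_ [_ [a Aa <-] [_ [b Ab <-] <-]]|_ [a Aa <-]].
- exists (a ^ h * b)%g; first by apply: subgroupM Ab => //; apply: Ah.
  by rewrite conjgE !mulgA mulgK.
- exists (g * 1)%g; first by exists 1%g => //; apply: subgroup1.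
  by exists (h * a)%g; [exists a | rewrite mulg1 mulgA].
Qed.

Let RH g a h : R g h -> H a -> R (g * a)%g h.
Proof. by move=> gh Ha; rewrite -[h]mulg1; apply: RM => //; exact: (R1 (HN Ha)).2. Qed.

Lemma rel_image_coset g h :
  N g -> P h -> R g h -> rel_image (left_coset g H) = left_coset h K.
Proof.
move=> Ng Ph gh; apply/seteqP; split=> [h' [Ph' [_ [a Ha <-] gah']]|_ [b Kb <-]].
- exists (h^-1 * h')%g; last by rewrite mulVKg.
  have Phh' : P (h^-1 * h')%g by apply: subgroupM => //; apply: subgroupV.
  apply/(R1' Phh').
  have := RM (RV gh) (RH gah' (subgroupV sgH Ha)).
  by rewrite mulgK mulVg.
- split; first by apply: subgroupM => //; apply: KP.
  exists g; first by exists 1%g; [apply: subgroup1 | rewrite mulg1].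
  by rewrite -[g]mulg1; apply: RM => //; exact: (R1' (KP Kb)).2.
Qed.

Lemma rel_of_image g h : N g -> P h ->
  rel_image (left_coset g H) = left_coset h K -> R g h.
Proof.
move=> Ng Ph gh; have : left_coset h K h.
  by exists 1%g; [apply: subgroup1 | rewrite mulg1].
rewrite -gh => -[_ [_ [a Ha <-] gah]].
by rewrite -[g](mulgK a); apply: RH => //; apply: subgroupV.
Qed.

(** Normality comes from the relation: [H] consists of the elements of [N] related to [1], and this
    property is stable under conjugation. *)
Let HJ g a : N g -> H a -> H (a ^ g)%g.
Proof.
move=> Ng Ha; have Nag : N (a ^ g)%g.
  rewrite conjgE; apply: subgroupM => //; first exact: subgroupV.
  by apply: subgroupM => //; apply: HN.
apply/(R1 Nag).
have [h Ph gh] := R_l Ng.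
have := RM (RV gh) (RM ((R1 (HN Ha)).2 Ha) gh).
by rewrite mul1g mulVg -conjgE.
Qed.

Let KJ h b : P h -> K b -> K (b ^ h)%g.
Proof.
move=> Ph Kb; have Pbh : P (b ^ h)%g.
  rewrite conjgE; apply: subgroupM => //; first exact: subgroupV.
  by apply: subgroupM => //; apply: KP.
apply/(R1' Pbh).
have [g Ng gh] := R_r Ph.
have := RM (RV gh) (RM ((R1' (KP Kb)).2 Kb) gh).
by rewrite mul1g mulVg -conjgE.
Qed.

Lemma quotient_iso_rel : quotient_iso N H P K rel_image.
Proof.
split; last first.
  move=> _ _ [g Ng <-] [g' Ng' <-].
  have [h Ph gh] := R_l Ng; have [h' Ph' gh'] := R_l Ng'.
  rewrite setmulg_coset // => [|a Ha]; last exact: HJ.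
  rewrite (rel_image_coset Ng Ph gh) (rel_image_coset Ng' Ph' gh').
  rewrite setmulg_coset // => [|a Ka]; last exact: KJ.
  by apply: rel_image_coset; [apply: subgroupM | apply: subgroupM | apply: RM].
split.
- move=> _ [g Ng <-]; have [h Ph gh] := R_l Ng.
  by exists h => //; rewrite (rel_image_coset Ng Ph gh).
- move=> _ _ /set_mem[g Ng <-] /set_mem[g' Ng' <-].
  have [h' Ph' gh'] := R_l Ng'; rewrite (rel_image_coset Ng' Ph' gh').
  move=> /(rel_of_image Ng Ph') gh; apply: left_coset_eq => //.
  have Ngg' : N (g^-1 * g')%g by apply: subgroupM => //; apply: subgroupV.
  apply/(R1 Ngg').
  by have := RM (RV gh) gh'; rewrite mulVg.
- move=> _ [h Ph <-]; have [g Ng gh] := R_r Ph.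
  by exists (left_coset g H); [exists g | apply: rel_image_coset].
Qed.

End QuotientRelation.

Local Open Scope ring_scope.

(** * Hilbert spaces and tensor products *)

Section HilbertTheory.
Variable C : numClosedFieldType.

Section Vectors.
Variable T : finType.
Implicit Types (x y z : hilb C T) (s t : T) (a : C).

Lemma vec_basis_sum x : x = \sum_t x t *: basis_vec t.
Proof.
apply/ffunP => s; rewrite sum_ffunE (bigD1 s) //= big1 => [|t /negPf ts].
  by rewrite addr0 !ffunE eqxx /GRing.scale /= mulr1.
by rewrite !ffunE eq_sym ts /GRing.scale /= mulr0.
Qed.

Lemma lfun_basisP (V : vectType C) (A B : 'Hom(hilb C T, V)) :
  (forall t, A (basis_vec t) = B (basis_vec t)) -> A = B.
Proof.
move=> AB; apply/lfunP => x; rewrite [x]vec_basis_sum !linear_sum.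
by apply: eq_bigr => t _; rewrite !linearZ /= AB.
Qed.

Lemma lfun_coordE (A : 'End(hilb C T)) x s :
  A x s = \sum_t A (basis_vec t) s * x t.
Proof.
rewrite {1}[x]vec_basis_sum linear_sum sum_ffunE; apply: eq_bigr => t _.
by rewrite linearZ ffunE mulrC.
Qed.

Lemma innerDl x y z : inner (x + y) z = inner x z + inner y z.
Proof. by rewrite -big_split; apply: eq_bigr => t _; rewrite ffunE mulrDl. Qed.

Lemma innerZl a x y : inner (a *: x) y = a * inner x y.
Proof. by rewrite mulr_sumr; apply: eq_bigr => t _; rewrite ffunE -mulrA. Qed.

Lemma inner_conj x y : inner y x = (inner x y)^*.
Proof.
rewrite rmorph_sum; apply: eq_bigr => t _.
by rewrite rmorphM /= conjCK mulrC.
Qed.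

Lemma innerDr x y z : inner x (y + z) = inner x y + inner x z.
Proof. by rewrite inner_conj innerDl rmorphD /= -!inner_conj. Qed.

Lemma innerZr a x y : inner x (a *: y) = a^* * inner x y.
Proof. by rewrite inner_conj innerZl rmorphM /= -inner_conj. Qed.

Lemma innerNr x y : inner x (- y) = - inner x y.
Proof. by rewrite -scaleN1r innerZr rmorphN1 mulN1r. Qed.

Lemma inner0l y : inner 0 y = 0.
Proof. by rewrite -(scale0r 0) innerZl mul0r. Qed.

Lemma inner0r y : inner y 0 = 0.
Proof. by rewrite inner_conj inner0l rmorph0. Qed.

Lemma inner_suml (I : Type) (r : seq I) (F : I -> hilb C T) y :
  inner (\sum_(i <- r) F i) y = \sum_(i <- r) inner (F i) y.
Proof.
by apply: (big_morph (inner ^~ y)) => [x z|]; rewrite ?innerDl ?inner0l.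
Qed.

Lemma inner_sumr (I : Type) (r : seq I) (F : I -> hilb C T) y :
  inner y (\sum_(i <- r) F i) = \sum_(i <- r) inner y (F i).
Proof.
by apply: (big_morph (inner y)) => [x z|]; rewrite ?innerDr ?inner0r.
Qed.

Lemma inner_eq0 x : inner x x = 0 -> x = 0.
Proof.
move=> /eqP; rewrite psumr_eq0 => [/allP x0|t _]; last exact: mul_conjC_ge0.
apply/ffunP => t; have := x0 t (mem_index_enum _).
by rewrite mul_conjC_eq0 ffunE => /eqP.
Qed.

Lemma inner_gt0 x : x != 0 -> 0 < inner x x.
Proof.
move=> x_neq0; rewrite lt_def sumr_ge0 => [|t _]; last exact: mul_conjC_ge0.
by rewrite andbT; apply: contra x_neq0 => /eqP/inner_eq0->.
Qed.

Lemma monomial_coord (A : 'End(hilb C T)) (p : T -> T) (c : T -> C) x t :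
  injective p -> (forall s, A (basis_vec s) = c s *: basis_vec (p s)) ->
  A x (p t) = c t * x t.
Proof.
move=> p_inj Ap; rewrite lfun_coordE (bigD1 t) //= big1 => [|s /negPf st].
  by rewrite Ap !ffunE eqxx /GRing.scale /= mulr1 addr0.
by rewrite Ap !ffunE (inj_eq p_inj) eq_sym st /GRing.scale /= mulr0 mul0r.
Qed.

Lemma monomial_unitary (A : 'End(hilb C T)) (p : T -> T) (c : T -> C) x y :
  injective p -> (forall t, c t * (c t)^* = 1) ->
  (forall s, A (basis_vec s) = c s *: basis_vec (p s)) ->
  inner (A x) (A y) = inner x y.
Proof.
move=> p_inj c1 Ap; rewrite /inner (reindex p) /=; last first.
  exact/onW_bij/injF_bij.
apply: eq_bigr => t _; rewrite !(monomial_coord _ _ p_inj Ap) rmorphM /=.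
by rewrite mulrACA c1 mul1r.
Qed.

Lemma monomial_inj (A : 'End(hilb C T)) (p : T -> T) (c : T -> C) :
  injective p -> (forall t, c t != 0) ->
  (forall s, A (basis_vec s) = c s *: basis_vec (p s)) -> lker A == 0%VS.
Proof.
move=> p_inj c0 Ap; apply/lker0P => x y /ffunP Axy; apply/ffunP => t.
by move: (Axy (p t)); rewrite !(monomial_coord _ _ p_inj Ap) => /(mulfI (c0 t)).
Qed.

End Vectors.

(** The range of [j] depends on [i]. Tagging puts all the ranges in one type, where the product can
    be expanded, and [fprod_of_dffun] leads back to multi-indices. *)
Lemma prod_sum_multi_index (k : nat) (e : 'I_k -> nat)
    (F : forall i : 'I_k, 'I_(e i) -> C) :
  \prod_i \sum_j F i j = \sum_(s : multi_index e) \prod_i F i (s i).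
Proof.
pose T_ i : finType := 'I_(e i); pose F' i : {ffun T_ i -> C} := [ffun j => F i j].
transitivity (\prod_i \sum_(j in tagged_with T_ i) untag 0 (F' i) j).
  apply: eq_bigr => i _; rewrite -(@big_tag _ _ _ _ T_ (fun i => F' i)).
  by apply: eq_bigr => j _; rewrite ffunE.
rewrite bigA_distr_big_dep -big_fprod.
rewrite (reindex (@fprod_of_dffun _ (fun i => 'I_(e i)))); last first.
  exact/onW_bij/fprod_of_dffun_bij.
by apply: eq_bigr => s _; apply: eq_bigr => i _; rewrite ffunE fprodE.
Qed.

Section Tensors.
Variables (k : nat) (e : 'I_k -> nat).
Implicit Types (A B : forall i, 'End(hilb C 'I_(e i))) (s t : multi_index e).

Lemma tensor_op_vec A (x : forall i, hilb C 'I_(e i)) :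
  tensor_op A (tensor_vec x) = tensor_vec (fun i => A i (x i)).
Proof.
apply/ffunP => t; rewrite op_mxE ffunE.
under [RHS]eq_bigr do rewrite lfun_coordE.
rewrite prod_sum_multi_index; apply: eq_bigr => s _.
by rewrite ffunE -big_split.
Qed.

Lemma tensor_op_comp A B :
  (tensor_op A \o tensor_op B)%VF = tensor_op (fun i => A i \o B i)%VF.
Proof.
apply: lfun_basisP => s; rewrite comp_lfunE !tensor_op_basis tensor_op_vec.
by apply/ffunP => t; rewrite !ffunE; apply: eq_bigr => i _; rewrite comp_lfunE.
Qed.

Lemma tensor_op_eq A B : (forall i, A i = B i) -> tensor_op A = tensor_op B.
Proof.
move=> AB; apply: lfun_basisP => s; apply/ffunP => t.
by rewrite !op_mx_basis; apply: eq_bigr => i _; rewrite AB.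
Qed.

Lemma tensor_op_monomial A (c : 'I_k -> C) s t :
  (forall i, A i (basis_vec (s i)) = c i *: basis_vec (t i)) ->
  tensor_op A (basis_vec s) = (\prod_i c i) *: basis_vec t.
Proof.
move=> Ac; rewrite tensor_op_basis -tensor_basis; apply/ffunP => r.
rewrite !ffunE /GRing.scale /= -big_split; apply: eq_bigr => i _.
by rewrite Ac ffunE.
Qed.

Lemma tensor_op_scalar (c : 'I_k -> C) :
  tensor_op (fun i => scalar_op (c i)) =
  scalar_op (\prod_i c i) :> 'End(hilb C (multi_index e)).
Proof.
apply: lfun_basisP => s; rewrite (@tensor_op_monomial _ c s s) => [|i].
  by rewrite !lfunE /= lfunE.
by rewrite !lfunE /= lfunE.
Qed.

End Tensors.
End HilbertTheory.

Section GLTheory.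
Variables (C : numClosedFieldType) (T : finType).
Implicit Types (g h : GL (hilb C T)) (x y : hilb C T) (t s : T) (zeta : C).

Lemma glM g h x : (g * h)%g x = g (h x). Proof. exact: comp_lfunE. Qed.

Lemma gl1 x : (1 : GL (hilb C T))%g x = x. Proof. exact: id_lfunE. Qed.

Lemma glK g x : (g^-1)%g (g x) = x.
Proof. by rewrite -glM mulVg gl1. Qed.

Lemma gl_basisP g h : (forall t, g (basis_vec t) = h (basis_vec t)) -> g = h.
Proof. by move=> gh; apply/val_inj/lfun_basisP. Qed.

Lemma gl_coord_eq g h : g = h -> forall x t, g x t = h x t.
Proof. by move->. Qed.

Lemma scalar_opE (c : C) x : scalar_op c x = c *: x.
Proof. by rewrite !lfunE /= lfunE. Qed.

Lemma scalar_op_inj (c : C) :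
  c != 0 -> lker (scalar_op c : 'End(hilb C T)) == 0%VS.
Proof.
by move=> c0; apply/lker0P => x y; rewrite !scalar_opE => /(scalerI c0).
Qed.

(** All Pauli operators have this shape. It yields their unitarity, the finiteness of the group, and
    the fact that its scalars are powers of [zeta]. *)
Definition root_monomial zeta g :=
  exists (p : T -> T) (c : T -> nat), injective p /\
    forall t, g (basis_vec t) = zeta ^+ c t *: basis_vec (p t).

Lemma subgroup_root_monomial (D : nat) zeta :
  (0 < D)%N -> zeta ^+ D = 1 -> subgroup [set g | root_monomial zeta g].
Proof.
move=> D_gt0 zD.
split=> [|g h [p [c [p_inj gp]]] [q [b [q_inj hq]]]|g [p [c [p_inj gp]]]] /=.
- by exists id, (fun=> 0%N); split=> // t; rewrite gl1 scale1r.
- exists (p \o q), (fun t => b t + c (q t))%N; split=> [|t].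
    exact: inj_comp.
  by rewrite glM hq linearZ /= gp scalerA -exprD.
- exists (invF p_inj), (fun t => c (invF p_inj t) * D.-1)%N; split=> [|t].
    exact: can_inj (f_invF p_inj).
  rewrite -[X in basis_vec X](f_invF p_inj) -[in RHS](glK g (basis_vec _)) gp.
  rewrite linearZ /= scalerA -exprD -mulnSr prednK // mulnC exprM zD expr1n.
  by rewrite scale1r f_invF.
Qed.

Lemma root_monomial_unitary (D : nat) zeta g x y : (0 < D)%N -> zeta ^+ D = 1 ->
  root_monomial zeta g -> inner (g x) (g y) = inner x y.
Proof.
move=> D_gt0 zD [p [c [p_inj gp]]]; apply: monomial_unitary p_inj _ gp => t.
have /eqP z1 : `|zeta| == 1 by rewrite -(pexpr_eq1 D_gt0) // -normrX zD normr1.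
by rewrite -normCK normrX z1 !expr1n.
Qed.

Lemma root_monomial_finite (D : nat) zeta : (0 < D)%N -> zeta ^+ D = 1 ->
  exists s : seq (GL (hilb C T)), forall g, root_monomial zeta g -> g \in s.
Proof.
move=> D_gt0 zD.
(* Finitely many data [f] suffice, as exponents count modulo [D]; data realised by no operator are
   sent to the default [1]. *)
pose gl_of (f : {ffun T -> T} * {ffun T -> 'I_D}) := xget (1%g : GL (hilb C T))
  [set g | forall t, g (basis_vec t) = zeta ^+ f.2 t *: basis_vec (f.1 t)].
exists [seq gl_of f | f <- enum {: {ffun T -> T} * {ffun T -> 'I_D}}].
move=> g [p [c [p_inj gp]]]; apply/mapP.
exists ([ffun t => p t], [ffun t => Ordinal (ltn_pmod (c t) D_gt0)]).
  by rewrite mem_enum.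
apply/esym/xget_unique => [t|h hp] /=.
  by rewrite !ffunE /= expr_mod // gp.
by apply: gl_basisP => t; rewrite hp gp !ffunE /= expr_mod.
Qed.

End GLTheory.

Section Shifts.
Variables (C : numClosedFieldType) (k : nat) (e : 'I_k -> nat).
Implicit Types (s t : multi_index e) (i j : 'I_k) (w : C).

Definition shift_at i s : multi_index e :=
  [ffun j => if j == i then ordS (s j) else s j].

Lemma shift_at_inj i : injective (shift_at i).
Proof.
move=> s t /ffunP st; apply/ffunP => j; have := st j.
by rewrite !ffunE; case: ifP => // _ /ordS_inj.
Qed.

Lemma shift_atC i j s : shift_at i (shift_at j s) = shift_at j (shift_at i s).
Proof. by apply/ffunP => l; rewrite !ffunE; do 2?case: ifP. Qed.

Lemma val_iter_ordS m (d : nat) (x : 'I_d) :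
  val (iter m (@ordS d) x) = ((x + m) %% d)%N :> nat.
Proof.
elim: m => [|m IHm]; first by rewrite addn0 modn_small.
by rewrite iterS /= IHm -addn1 modnDml addn1 addnS.
Qed.

Lemma iter_shift_at m i s j :
  val (iter m (shift_at i) s j) =
    if j == i then ((s j + m) %% e j)%N else s j :> nat.
Proof.
have -> : iter m (shift_at i) s j = if j == i then iter m (@ordS _) (s j) else s j.
  elim: m => [|m IHm]; first by rewrite /= if_same.
  by rewrite iterS ffunE IHm; case: (j == i).
by case: ifP => // _; rewrite val_iter_ordS.
Qed.

Lemma shift_closed_full (Q : multi_index e -> Prop) :
  (forall i s, Q s -> Q (shift_at i s)) -> forall s t, Q s -> Q t.
Proof.
move=> Q_shift s t.
suff: forall (r : seq 'I_k) s, (forall j, j \notin r -> s j = t j) -> Q s -> Q t.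
  by move=> /(_ (enum 'I_k)); apply=> j; rewrite mem_enum.
elim=> [|i r IHr] {}s st Qs.
  by have -> : t = s by apply/ffunP => j; rewrite st.
(* This many shifts carry coordinate [i] from [s i] to [t i] modulo [e i]; adding [e i] keeps the
   difference in [nat]. *)
apply: (IHr (iter (t i + (e i - s i))%N (shift_at i) s)) => [j j_r|].
  apply: val_inj; rewrite iter_shift_at; case: eqP => [->|/eqP ji]; last first.
    by rewrite st // inE (negPf ji).
  by rewrite addnCA subnKC ?modnDr ?modn_small // ltnW.
by elim: (t i + _)%N => //= m IHm; apply: Q_shift.
Qed.

Definition shift_op_at i : 'End(hilb C (multi_index e)) :=
  tensor_op (fun j => if j == i then shift_op (e j) else \1%VF).

Definition clock_op_at w i : 'End(hilb C (multi_index e)) :=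
  tensor_op (fun j => if j == i then clock_op (e j) w else \1%VF).

Lemma shift_op_atE i s : shift_op_at i (basis_vec s) = basis_vec (shift_at i s).
Proof.
have -> : basis_vec (shift_at i s) =
    (\prod_(j < k) (1 : C)) *: basis_vec (shift_at i s).
  by rewrite big1 ?scale1r.
apply: (@tensor_op_monomial _ _ _ _ (fun=> 1)) => j.
by rewrite ffunE scale1r; case: ifP; rewrite ?shift_op_basis ?lfunE.
Qed.

Lemma clock_op_atE w i s :
  clock_op_at w i (basis_vec s) = w ^+ s i *: basis_vec s.
Proof.
have -> : w ^+ s i = \prod_j (if j == i then w ^+ s j else 1).
  by rewrite -big_mkcond big_pred1_eq.
apply: tensor_op_monomial => j.
by case: ifP; rewrite ?clock_op_basis ?lfunE /= ?scale1r.
Qed.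

End Shifts.

(** * The Pauli group *)

(** Compare coordinates at [p t]: if [p t] differed from [t], a power of [zeta] would vanish. *)
Lemma root_monomial_scalar (C : numClosedFieldType) (T : finType) (zeta : C)
    (g : GL (hilb C T)) (c : C) (t : T) : zeta != 0 -> root_monomial zeta g ->
  (forall s, g (basis_vec s) = c *: basis_vec s) -> exists i, c = zeta ^+ i.
Proof.
move=> z0 [p [a [p_inj gp]]] gc; exists (a t).
move: (gc t); rewrite gp => /ffunP/(_ (p t)); rewrite !ffunE eqxx.
rewrite /GRing.scale /= mulr1; case: eqP => _; first by rewrite mulr1.
by move/eqP; rewrite mulr0 expf_eq0 (negPf z0) andbF.
Qed.

Section PauliGroup.
Variables (C : numClosedFieldType) (n d : nat) (zeta : C).
Hypotheses (d_gt0 : (0 < d)%N) (prim : (dbar d).-primitive_root zeta).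
Notation D := (dbar d).
Notation e := (fun _ : 'I_n => d).
Notation T := (multi_index e).
Notation V := (hilb C T).
Notation P := (pauli n d zeta).
Implicit Types (g h : GL V) (r : 'I_n) (s t : T) (x y v : V).

Lemma dbar_gt0 : (0 < D)%N. Proof. exact: prim_order_gt0 prim. Qed.

Lemma dvdn_dbar : (d %| D)%N.
Proof. by rewrite /dbar; case: odd; rewrite ?dvdn_mull. Qed.

Lemma zeta_dbar : zeta ^+ D = 1. Proof. exact: prim_expr_order. Qed.

Lemma zeta_neq0 : zeta != 0.
Proof. by rewrite (prim_root_eq0 prim) -lt0n dbar_gt0. Qed.

Lemma zeta_eq1 i : zeta ^+ i = 1 <-> (D %| i)%N.
Proof. by rewrite (prim_order_dvd prim); split=> /eqP. Qed.

Lemma xi_eq1 i : zeta ^+ (2 * i) = 1 <-> (d %| i)%N.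
Proof.
rewrite zeta_eq1 /dbar; case: ifP => odd_d; last by rewrite dvdn_pmul2l.
by rewrite Gauss_dvdr // coprimen2.
Qed.

Definition zeta_gl : GL V := MkGL (scalar_op_inj T zeta_neq0).

Lemma shift_gl_inj r : lker (@shift_op_at C n e r) == 0%VS.
Proof.
apply: (@monomial_inj _ _ _ (shift_at r) (fun=> 1)) => [|t|s].
- exact: shift_at_inj.
- exact: oner_neq0.
- by rewrite shift_op_atE scale1r.
Qed.

Lemma clock_gl_inj r : lker (@clock_op_at C n e (zeta ^+ 2) r) == 0%VS.
Proof.
apply: (@monomial_inj _ _ _ id (fun s => (zeta ^+ 2) ^+ s r)) => [//|t|s].
- by rewrite !expf_neq0 // zeta_neq0.
- by rewrite clock_op_atE.
Qed.

Definition shift_gl r : GL V := MkGL (shift_gl_inj r).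
Definition clock_gl r : GL V := MkGL (clock_gl_inj r).

Lemma zeta_glE i x : (zeta_gl ^+ i)%g x = zeta ^+ i *: x.
Proof.
elim: i x => [|i IHi] x; first by rewrite gl1 scale1r.
by rewrite expgSr glM IHi /= scalar_opE scalerA -exprSr.
Qed.

Lemma shift_glE r s : shift_gl r (basis_vec s) = basis_vec (shift_at r s).
Proof. exact: shift_op_atE. Qed.

Lemma clock_glE r s :
  clock_gl r (basis_vec s) = (zeta ^+ 2) ^+ s r *: basis_vec s.
Proof. exact: clock_op_atE. Qed.

Lemma clock_gl_coord r x s : clock_gl r x s = (zeta ^+ 2) ^+ s r * x s.
Proof.
apply: (@monomial_coord _ _ _ id (fun s => (zeta ^+ 2) ^+ s r)) => // t.
exact: clock_glE.
Qed.

Lemma zeta_gl_central g : commute zeta_gl g.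
Proof.
by apply: gl_basisP => t; rewrite !glM -[zeta_gl]expg1 !zeta_glE linearZ.
Qed.

Inductive pauli_generator : GL V -> Prop :=
  | ShiftGenerator r : pauli_generator (shift_gl r)
  | ClockGenerator r : pauli_generator (clock_gl r)
  | ZetaGenerator : pauli_generator zeta_gl.

Lemma pauliE : P = subgroup_gen pauli_generator.
Proof.
congr subgroup_gen; apply/seteqP; split=> [g|_ [r|r|]] /=.
- case=> [[r gE]|[r gE]|gE].
  + have -> : g = shift_gl r by apply: val_inj; rewrite /= gE.
    by constructor.
  + have -> : g = clock_gl r by apply: val_inj; rewrite /= gE.
    by constructor.
  + have -> : g = zeta_gl by apply: val_inj; rewrite /= gE.
    by constructor.
- by constructor 1; exists r.
- by constructor 2; exists r.
- by constructor 3.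
Qed.

Lemma subgroup_pauli : subgroup P. Proof. exact: subgroup_gen_subgroup. Qed.

Lemma pauli_gen g : pauli_generator g -> P g.
Proof. by rewrite pauliE; apply: sub_subgroup_gen. Qed.

Lemma zeta_gl_eq1 i : (zeta_gl ^+ i)%g = 1%g <-> (D %| i)%N.
Proof.
rewrite -zeta_eq1; split=> [zi|zi]; last first.
  by apply: gl_basisP => t; rewrite zeta_glE zi scale1r gl1.
pose t : T := [ffun=> Ordinal d_gt0].
have := zeta_glE i (basis_vec t); rewrite zi gl1 => /ffunP/(_ t).
by rewrite !ffunE eqxx /GRing.scale /= mulr1 => <-.
Qed.

Notation xi := (zeta_gl ^+ 2)%g.

Lemma xi_gl_eq1 i : (xi ^+ i)%g = 1%g <-> (d %| i)%N.
Proof. by rewrite -expgnA zeta_gl_eq1 -xi_eq1 -zeta_eq1. Qed.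

Lemma xi_gl_d : (xi ^+ d)%g = 1%g. Proof. exact/xi_gl_eq1. Qed.

Lemma xi_gl_central g : commute xi g.
Proof. exact/commute_sym/commuteX/commute_sym/zeta_gl_central. Qed.


Lemma xi_d : (zeta ^+ 2) ^+ d = 1. Proof. by rewrite -exprM; apply/xi_eq1. Qed.

Lemma clock_shift r r' : comm_exp xi (clock_gl r) (shift_gl r') (r == r').
Proof.
apply: gl_basisP => s; rewrite -expgnA !glM zeta_glE shift_glE !clock_glE.
rewrite linearZ /= shift_glE scalerA exprM -exprD; congr (_ *: _).
rewrite ffunE; case: eqP => _ //=.
by rewrite expr_mod ?xi_d // exprS.
Qed.

Lemma pauli_generator_comm g h : pauli_generator g -> pauli_generator h ->
  exists i, comm_exp xi g h i.
Proof.
have scal g' i : comm_exp xi g' (zeta_gl ^+ i)%g 0.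
  by apply/comm_exp0; apply: commuteX; apply/commute_sym/zeta_gl_central.
have sym := comm_exp_sym xi_gl_d d_gt0.
case=> [r|r|] [r'|r'|]; try by exists 0%N; apply: (scal _ 1%N).
- exists 0%N; apply/comm_exp0; apply: gl_basisP => s.
  by rewrite !glM !shift_glE shift_atC.
- by eexists; apply/sym/clock_shift.
- by eexists; apply: clock_shift.
- exists 0%N; apply/comm_exp0; apply: gl_basisP => s.
  by rewrite !glM !clock_glE !linearZ /= !clock_glE !scalerA mulrC.
- by eexists; apply/sym/(scal _ 1%N).
- by eexists; apply/sym/(scal _ 1%N).
Qed.

Lemma pauli_comm g h : P g -> P h -> exists i, comm_exp xi g h i.
Proof.
rewrite !pauliE.
exact: (comm_exp_gen xi_gl_central xi_gl_d d_gt0 pauli_generator_comm).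
Qed.

Lemma pauli_exponent g : P g -> (g ^+ D = 1)%g.
Proof.
rewrite pauliE.
apply: (exponent_gen xi_gl_central xi_gl_d d_gt0 pauli_generator_comm).
(* Since [xi] is the square of [zeta_gl], the exponent becomes [2 * 'C(D, 2) = D * (D - 1)]. *)
- rewrite -expgnA; apply/zeta_gl_eq1; rewrite -mul_bin_diag.
  exact: dvdn_mulr.
- move=> _ [r|r|]; last by apply/zeta_gl_eq1.
  + apply: gl_basisP => s; rewrite gl1.
    have -> m : (shift_gl r ^+ m)%g (basis_vec s) = basis_vec (iter m (shift_at r) s).
      by elim: m => [|m IHm]; rewrite ?gl1 // expgS glM IHm shift_glE.
    congr basis_vec; apply/ffunP => j; apply: val_inj; rewrite iter_shift_at.
    case: eqP => // _; have /dvdnP[q ->] := dvdn_dbar.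
    by rewrite addnC modnMDl modn_small.
  + apply: gl_basisP => s; rewrite gl1.
    have -> m : (clock_gl r ^+ m)%g (basis_vec s) =
        ((zeta ^+ 2) ^+ s r) ^+ m *: basis_vec s.
      elim: m => [|m IHm]; first by rewrite gl1 scale1r.
      by rewrite expgS glM IHm linearZ /= clock_glE scalerA -exprSr.
    by rewrite exprAC [(zeta ^+ 2) ^+ D]exprAC zeta_dbar !expr1n scale1r.
Qed.

Lemma pauli_monomial g : P g -> root_monomial zeta g.
Proof.
have sgM := @subgroup_root_monomial C T _ _ dbar_gt0 zeta_dbar.
rewrite pauliE; apply: (subgroup_gen_min sgM) => _ [r|r|].
- exists (shift_at r), (fun=> 0%N); split=> [|t]; first exact: shift_at_inj.
  by rewrite shift_glE scale1r.
- exists id, (fun t => 2 * t r)%N; split=> // t.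
  by rewrite clock_glE exprM.
- by exists id, (fun=> 1%N); split=> // t; rewrite -[zeta_gl]expg1 zeta_glE.
Qed.

Lemma pauli_unitary g x y : P g -> inner (g x) (g y) = inner x y.
Proof.
by move/pauli_monomial; apply: root_monomial_unitary dbar_gt0 zeta_dbar.
Qed.

Lemma pauli_finite : exists s : seq (GL V), forall g, P g -> g \in s.
Proof.
have [s sP] := root_monomial_finite T dbar_gt0 zeta_dbar.
by exists s => g /pauli_monomial; apply: sP.
Qed.


End PauliGroup.

(** * Centre, traces and irreducibility of the Pauli group *)

Section PauliRepresentation.
Variables (C : numClosedFieldType) (n d : nat) (zeta : C).
Hypotheses (d_gt0 : (0 < d)%N) (prim : (dbar d).-primitive_root zeta).
Notation D := (dbar d).
Notation T := (multi_index (fun _ : 'I_n => d)).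
Notation V := (hilb C T).
Notation P := (pauli n d zeta).
Notation zt := (zeta_gl n prim).
Notation xi := (zt ^+ 2)%g.
Notation generator := (@pauli_generator C n d zeta prim).
Implicit Types (g h : GL V) (r : 'I_n) (s t : T) (x y v : V).

Lemma xi_prim : d.-primitive_root (zeta ^+ 2).
Proof.
have := exp_prim_root prim 2; rewrite /dbar; case: ifP => odd_d.
  have /eqP-> : coprime 2 d by rewrite coprime2n.
  by rewrite divn1.
by rewrite -{2}[2%N]muln1 -muln_gcdr gcd1n muln1 mulKn.
Qed.

Lemma xi_inj (a b : 'I_d) : (zeta ^+ 2) ^+ a = (zeta ^+ 2) ^+ b -> a = b.
Proof.
move/eqP; rewrite (eq_prim_root_expr xi_prim) !modn_small // => /eqP.
exact: val_inj.
Qed.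

Lemma multi_index_neq (k : nat) (e : 'I_k -> nat) (s t : multi_index e) :
  s != t -> exists i, s i != t i.
Proof.
move=> st; apply/existsP; rewrite -negb_forall; apply: contra st.
by move/forallP=> st; apply/eqP/ffunP => r; apply/eqP.
Qed.

(** The joint eigenvalues of the clocks separate the basis vectors, so [g] is diagonal; the shifts
    permute the basis transitively, so the diagonal is constant. *)
Lemma commute_generators_scalar g : (forall h, generator h -> commute g h) ->
  exists c, forall t, g (basis_vec t) = c *: basis_vec t.
Proof.
move=> gC; have gE t : g (basis_vec t) = g (basis_vec t) t *: basis_vec t.
  apply/ffunP => s; rewrite !ffunE; case: eqP => [->|/eqP st].
    by rewrite /GRing.scale /= mulr1.
  rewrite /GRing.scale /= mulr0; have [r str] := multi_index_neq st.
  have := gl_coord_eq (gC _ (ClockGenerator _ r)) (basis_vec t) s.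
  rewrite !glM clock_gl_coord clock_glE linearZ ffunE /GRing.scale /=.
  move/eqP; rewrite -subr_eq0 -mulrBl mulf_eq0 subr_eq0.
  move=> /orP[/eqP/xi_inj ts|/eqP//].
  by rewrite ts eqxx in str.
have gS r t : g (basis_vec (shift_at r t)) (shift_at r t) = g (basis_vec t) t.
  have := gl_coord_eq (gC _ (ShiftGenerator _ r)) (basis_vec t) (shift_at r t).
  rewrite !glM shift_glE => ->; rewrite gE linearZ /= shift_glE !ffunE !eqxx.
  by rewrite /GRing.scale /= !mulr1.
pose t0 : T := [ffun=> Ordinal d_gt0]; exists (g (basis_vec t0) t0) => t.
rewrite gE; congr (_ *: _).
by apply: (@shift_closed_full _ _
  (fun s => g (basis_vec s) s = g (basis_vec t0) t0) _ t0) => // r s; rewrite gS.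
Qed.

Lemma pauli_central g :
  P g -> (forall h, generator h -> commute g h) -> exists i, g = (zt ^+ i)%g.
Proof.
move=> Pg /commute_generators_scalar[c gc].
have [i ci] := root_monomial_scalar [ffun=> Ordinal d_gt0] (zeta_neq0 prim)
  (pauli_monomial prim Pg) gc.
by exists i; apply: gl_basisP => t; rewrite gc zeta_glE ci.
Qed.

(** A non-scalar [g] fails to commute with some generator [h]; conjugation by [h] multiplies [g],
    hence its trace, by a root of unity other than 1. *)
Lemma pauli_trace g :
  P g -> (forall i, g <> (zt ^+ i)%g) -> \sum_t g (basis_vec t) t = 0.
Proof.
move=> Pg g_zt; have [h gen_h cgh] : exists2 h, generator h & ~ commute h g.
  apply: contrapT => nh; have [|i] := pauli_central Pg; last exact: g_zt.
  move=> h gen_h; apply: commute_sym; apply: contrapT => hg.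
  by apply: nh; exists h.
have Ph := pauli_gen gen_h; have [i hg] := pauli_comm d_gt0 prim Ph Pg.
have [p [a [p_inj hp]]] := pauli_monomial prim Ph.
have c1 : zeta ^+ (2 * i) != 1.
  by apply/eqP => c1; apply: cgh; move: hg; rewrite /comm_exp -expgnA
    (_ : zt ^+ _ = 1)%g ?mul1g //; apply/zeta_gl_eq1/(zeta_eq1 prim).
have step t : g (basis_vec t) t = zeta ^+ (2 * i) * g (basis_vec (p t)) (p t).
  have := gl_coord_eq hg (basis_vec t) (p t).
  rewrite -expgnA !glM zeta_glE (monomial_coord _ _ p_inj hp) hp linearZ.
  rewrite !ffunE /GRing.scale /= mulrCA; apply: mulfI.
  by rewrite expf_neq0 // (zeta_neq0 prim).
have : (1 - zeta ^+ (2 * i)) * (\sum_t g (basis_vec t) t) = 0.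
  rewrite mulrBl mul1r mulr_sumr [X in _ - X](reindex p) /=; last first.
    exact/onW_bij/injF_bij.
  by rewrite -sumrB big1 // => t _; rewrite step subrr.
by move/eqP; rewrite mulf_eq0 subr_eq0 eq_sym (negPf c1) => /eqP.
Qed.

(** The clocks cut the support of a nonzero vector of [M] down to a single basis vector, from which
    the shifts reach all the others. *)
Lemma pauli_irreducible (M : V -> Prop) v :
  (forall a x y, M x -> M y -> M (a *: x + y)) ->
  (forall g x, P g -> M x -> M (g x)) -> M v -> v != 0 -> forall x, M x.
Proof.
move=> Mlin MP Mv v0.
have M0 : M 0 by have := Mlin (-1) v v Mv Mv; rewrite scaleN1r addNr.
have MZ a x : M x -> M (a *: x) by move=> Mx; rewrite -[_ *: _]addr0; apply: Mlin.
suff [t0 Mt0] : exists t, M (basis_vec t).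
  move=> x; rewrite [x]vec_basis_sum; apply: big_ind => // [y z My Mz|t _].
    by rewrite -[y]scale1r; apply: Mlin.
  apply/MZ; apply: (@shift_closed_full _ _ (fun s => M (basis_vec s)) _ t0) =>
    // r s Ms.
  rewrite -(@shift_glE C n d); apply: MP => //; apply: pauli_gen.
  exact: ShiftGenerator.
have [m] := ubnP #|[pred t | v t != 0]|; elim: m => // m IHm in v v0 Mv *.
move=> /ltnSE le_v_m; have [t vt] : exists t, v t != 0.
  apply: contrapT => nv; move/eqP: v0; apply; apply/ffunP => t; rewrite ffunE.
  by apply: contrapT => vt; apply: nv; exists t; apply/eqP.
have [[t' [t't vt']]|one] := pselect (exists t', t' != t /\ v t' != 0); last first.
  exists t; suff -> : basis_vec t = (v t)^-1 *: v by apply: MZ.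
  apply/ffunP => s; rewrite !ffunE /GRing.scale /=; case: eqP => [->|/eqP st].
    by rewrite mulVf.
  have [->|vs] := eqVneq (v s) 0; first by rewrite mulr0.
  by case: one; exists s.
have [r t'tr] := multi_index_neq t't.
(* Subtracting the eigenvalue at [t'] kills that coordinate and keeps the one at [t], since [t] and
   [t'] differ at [r]. *)
pose w := - (zeta ^+ 2) ^+ t' r *: v + clock_gl prim r v.
have wE s : w s = ((zeta ^+ 2) ^+ s r - (zeta ^+ 2) ^+ t' r) * v s.
  by rewrite !ffunE clock_gl_coord /GRing.scale /= mulrBl mulNr addrC.
apply: (IHm w).
- apply/eqP => /ffunP/(_ t)/eqP; rewrite wE ffunE mulf_eq0 (negPf vt) orbF.
  by rewrite subr_eq0 => /eqP/xi_inj tt'; rewrite tt' eqxx in t'tr.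
- by apply: Mlin => //; apply: MP => //; apply: pauli_gen; apply: ClockGenerator.
- apply: leq_trans le_v_m; apply: proper_card; apply/properP; split.
    by apply/fintype.subsetP => s; rewrite !inE wE mulf_eq0 negb_or => /andP[].
  by exists t'; rewrite !inE // wE subrr mul0r eqxx.
Qed.

End PauliRepresentation.

(** * The stabilised subspace *)

Section Eigenvectors.
Variables (C : numClosedFieldType) (T : finType).
Implicit Types (g : GL (hilb C T)) (v w : hilb C T).

(* The average of [z ^ (j m) g ^ m w] over [m < D] is an eigenvector or zero,
   and summing these averages over [j < D] gives back [w]. *)
Lemma root_eigenvector (D : nat) (z : C) (W : hilb C T -> Prop) g w :
  D.-primitive_root z -> (g ^+ D = 1)%g ->
  (forall a x y, W x -> W y -> W (a *: x + y)) -> (forall x, W x -> W (g x)) ->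
  W w -> w != 0 -> exists j v, [/\ W v, v != 0 & g v = z ^+ j *: v].
Proof.
move=> z_prim gD Wlin Wg Ww w0; have D_gt0 := prim_order_gt0 z_prim.
have W0 : W 0 by have := Wlin (-1) w w Ww Ww; rewrite scaleN1r addNr.
have WX m : W ((g ^+ m)%g w).
  by elim: m => [|m IHm]; rewrite ?gl1 // expgS glM; apply: Wg.
pose f j m := z ^+ (j * m) *: (g ^+ m)%g w.
pose v j := \sum_(m < D) f j m.
have Wv j : W (v j).
  apply: big_ind => // [x y Wx Wy|m _]; first by rewrite -[x]scale1r; apply: Wlin.
  by rewrite -[f j m]addr0; apply: Wlin.
have gv j : g (v j) = z ^+ (j * D.-1) *: v j.
  have gf m : z ^+ j *: g (f j m) = f j m.+1.
    by rewrite linearZ /= scalerA -exprD -mulnS /f expgS glM.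
  have cyc : z ^+ j *: g (v j) = v j.
    rewrite linear_sum scaler_sumr (eq_bigr (fun m : 'I_D => f j m.+1)) => [|m _].
      rewrite /v -(prednK D_gt0) big_ord_recr [RHS]big_ord_recl /= addrC.
      congr (_ + _); rewrite prednK // /f gD muln0 mulnC exprM.
      by rewrite (prim_expr_order z_prim) expr1n.
    exact: gf.
  rewrite -[in RHS]cyc scalerA -exprD -mulnSr prednK // mulnC exprM.
  by rewrite (prim_expr_order z_prim) expr1n scale1r.
have [[j vj]|nv] := pselect (exists j, v j != 0).
  by exists (j * D.-1)%N, (v j).
have : \sum_(j < D) v j = D%:R *: w.
  rewrite exchange_big /= (bigD1 (Ordinal D_gt0)) //= [X in _ + X]big1 => [|m m0].
    rewrite addr0 /f (eq_bigr (fun=> w)) => [|j _].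
      by rewrite sumr_const card_ord scaler_nat.
    by rewrite muln0 scale1r gl1.
  rewrite /f -scaler_suml (eq_bigr (fun j : 'I_D => (z ^+ m) ^+ j)) => [|j _].
    have : (z ^+ m - 1) * (\sum_(j < D) (z ^+ m) ^+ j) = 0.
      by rewrite -subrX1 exprAC (prim_expr_order z_prim) expr1n subrr.
    move/eqP; rewrite mulf_eq0 subr_eq0 => /orP[|/eqP->]; last by rewrite scale0r.
    rewrite -(prim_order_dvd z_prim) /dvdn modn_small // => /eqP m0'.
    by case/negP: m0; apply/eqP/val_inj.
  by rewrite mulnC exprM.
rewrite big1 => [/esym/eqP|j _].
  by rewrite scaler_eq0 (negPf w0) orbF (negPf (prim_root_natf_neq0 z_prim)).
by apply: contrapT => /eqP vj; apply: nv; exists j.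
Qed.

End Eigenvectors.

Section Stabilizer.
Variables (C : numClosedFieldType) (n d : nat) (zeta : C).
Hypotheses (d_gt0 : (0 < d)%N) (prim : (dbar d).-primitive_root zeta).
Notation D := (dbar d).
Notation T := (multi_index (fun _ : 'I_n => d)).
Notation V := (hilb C T).
Notation P := (pauli n d zeta).
Notation zt := (zeta_gl n prim).
Notation xi := (zt ^+ 2)%g.
Variable H : set (GL V).
Hypotheses (sgH : subgroup H) (HP : H `<=` P) (cH : commutative_set H).
Hypothesis H_zt : forall i, H (zt ^+ i)%g -> (zt ^+ i)%g = 1%g.
Notation W := (fixed_by H).
Notation N := (normaliser_in P H).
Implicit Types (g h : GL V) (t : T) (u v x y : V).

Lemma fixed_by_linear a x y : W x -> W y -> W (a *: x + y).
Proof. by move=> Wx Wy h Hh; rewrite linearP /= Wx ?Wy. Qed.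

Let sgP : subgroup P := @subgroup_pauli C n d zeta.

Let ztC i g : commute (zt ^+ i)%g g.
Proof. exact/commute_sym/commuteX/commute_sym/zeta_gl_central. Qed.

Lemma normaliserP g : N g <-> P g /\ forall h, H h -> commute g h.
Proof.
split=> [[Pg gH]|[Pg cgH]]; last first.
  split=> //; apply/seteqP; split=> [_ [h Hh <-]|h Hh].
    by rewrite /conjg -(cgH _ Hh) mulKg.
  by exists h => //; rewrite /conjg -(cgH _ Hh) mulKg.
split=> // h Hh; have [i hg] := pauli_comm d_gt0 prim (HP Hh) Pg.
have Hhg : H (h ^ g)%g by rewrite -gH; exists h.
have hgE : (h ^ g = zt ^+ (2 * i) * h)%g.
  by rewrite /conjg hg -expgnA mulgA -(ztC _ g^-1%g) -mulgA mulKg.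
have /H_zt z1 : H (zt ^+ (2 * i))%g.
  by rewrite -[(zt ^+ _)%g](mulgK h) -hgE; apply: subgroupM => //; apply: subgroupV.
by rewrite /commute hg -expgnA z1 mul1g.
Qed.

Lemma subgroup_normaliser : subgroup N.
Proof.
suff -> : N = P `&` [set g | forall h, H h -> commute g h].
  exact: (subgroupI sgP (subgroup_commute H)).
by apply/seteqP; split=> g /normaliserP.
Qed.

Lemma sub_normaliser : H `<=` N.
Proof. by move=> g Hg; apply/normaliserP; split=> [|h]; [apply: HP | apply: cH]. Qed.

Lemma zeta_gl_pauli i : P (zt ^+ i)%g.
Proof. exact: subgroupX sgP (pauli_gen (ZetaGenerator n prim)). Qed.

Lemma zeta_gl_normaliser i : N (zt ^+ i)%g.
Proof. by apply/normaliserP; split=> [|h _]; [apply: zeta_gl_pauli | apply: ztC]. Qed.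

Lemma fixed_by_normaliser g x : N g -> W x -> W (g x).
Proof.
by move=> /normaliserP[_ cg] Wx h Hh; rewrite -glM -cg // glM Wx.
Qed.

Lemma stabilizer_enum : exists2 s : seq (GL V), uniq s & forall g, g \in s <-> H g.
Proof.
have [s sP] := pauli_finite n prim.
exists (undup [seq g <- s | `[< H g >]]); first exact: undup_uniq.
move=> g; rewrite mem_undup mem_filter; split=> [/andP[/asboolP]//|Hg].
by apply/andP; split; [apply/asboolP | apply: sP; apply: HP].
Qed.

Lemma trace_id_neq0 : \sum_t (1 : GL V)%g (basis_vec t) t != 0.
Proof.
rewrite (eq_bigr (fun=> 1)) => [|t _]; last by rewrite gl1 ffunE eqxx.
rewrite sumr_const pnatr_eq0 -lt0n; apply/card_gt0P.
by exists [ffun=> Ordinal d_gt0].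
Qed.

Lemma fixed_sum (s : seq (GL V)) x :
  uniq s -> (forall g, g \in s <-> H g) -> W (\sum_(h <- s) h x).
Proof.
move=> s_uniq sP g Hg; rewrite linear_sum /=.
rewrite (eq_bigr (fun h => (g * h)%g x)) => [|h _]; last by rewrite glM.
rewrite -(big_map (fun h => g * h)%g predT (fun h : GL V => h x)).
apply/perm_big/uniq_perm => //.
  by rewrite map_inj_uniq // => h h'; apply: mulgI.
move=> h; apply/mapP/idP => [[h' /sP Hh' ->]|/sP Hh].
  by apply/sP; apply: subgroupM.
exists (g^-1 * h)%g; last by rewrite mulVKg.
by apply/sP; apply: subgroupM => //; apply: subgroupV.
Qed.

(** Only [h = 1] contributes: by [H_zt] the other elements of [H] are not scalar, hence
    traceless. *)
Lemma fixed_trace (s : seq (GL V)) :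
  uniq s -> (forall g, g \in s <-> H g) ->
  \sum_t (\sum_(h <- s) h (basis_vec t)) t != 0.
Proof.
move=> s_uniq sP; rewrite (eq_bigr (fun t => \sum_(h <- s) h (basis_vec t) t)).
  rewrite exchange_big /= (bigD1_seq 1%g) //=; last by apply/sP; apply: subgroup1.
  rewrite [X in _ + X]big_seq_cond [X in _ + X]big1 ?addr0 ?trace_id_neq0 //.
  move=> h /andP[/sP Hh h1].
  apply: (@pauli_trace C n d zeta d_gt0 prim h) => [|i hi]; first exact: HP.
  by move: Hh h1; rewrite hi => /H_zt->; rewrite eqxx.
by move=> t _; rewrite sum_ffunE.
Qed.

Lemma fixed_by_neq0 : exists2 v, W v & v != 0.
Proof.
have [s s_uniq sP] := stabilizer_enum; apply: contrapT => nv.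
have /eqP := fixed_trace s_uniq sP; apply; apply: big1 => t _.
have [->|w0] := eqVneq (\sum_(h <- s) h (basis_vec t)) 0; first by rewrite ffunE.
by case: nv; exists (\sum_(h <- s) h (basis_vec t)) => //; apply: fixed_sum.
Qed.

(* Otherwise no [g * h], [h] in [H], is scalar, so they all have trace 0,
   whereas [g] fixes the vectors [\sum_(h in H) h (basis_vec t)]. *)
Lemma fix_fixed_by g : P g -> (forall v, W v -> g v = v) -> H g.
Proof.
move=> Pg gW; have [s s_uniq sP] := stabilizer_enum.
have [[i [h [Hh ghE]]]|no_scalar] :=
    pselect (exists i h, H h /\ (g * h = zt ^+ i)%g); last first.
  have /eqP[] := fixed_trace s_uniq sP.
  rewrite (eq_bigr (fun t => \sum_(h <- s) (g * h)%g (basis_vec t) t)) => [|t _].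
    rewrite exchange_big big_seq_cond big1 // => h /andP[/sP Hh _].
    apply: (@pauli_trace C n d zeta d_gt0 prim (g * h)%g) => [|i ghi].
      exact: subgroupM sgP Pg (HP Hh).
    by apply: no_scalar; exists i, h.
  rewrite -[in LHS](gW _ (fixed_sum _ s_uniq sP)) linear_sum sum_ffunE.
  by apply: eq_bigr => h _; rewrite glM.
have [v Wv v0] := fixed_by_neq0; have gh1 : (g * h = 1)%g.
  have : zeta ^+ i *: v = v by rewrite -(zeta_glE prim) -ghE glM Wv // gW.
  move/eqP; rewrite -subr_eq0 -{2}[v]scale1r -scalerBl scaler_eq0 (negPf v0) orbF.
  rewrite subr_eq0 => /eqP zi; rewrite ghE.
  exact: (zeta_gl_eq1 n d_gt0 prim i).2 ((zeta_eq1 prim i).1 zi).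
by rewrite -[g](mulgK h) gh1 mul1g; apply: subgroupV.
Qed.

(** For [g] in the Pauli group but outside [N], some [h] in [H] commutes with [g] only up to a root
    of unity other than 1. As [h] is unitary and fixes [u] and [v], the product [inner (g v) u]
    vanishes by itself. So [u] is orthogonal to the whole Pauli orbit of [v], and irreducibility
    makes it orthogonal to itself. *)
Lemma normaliser_irreducible u v : W u -> W v -> v != 0 ->
  (forall g, N g -> inner (g v) u = 0) -> u = 0.
Proof.
move=> Wu Wv v0 Nvu.
pose M x := forall g, P g -> inner (g x) u = 0.
have Mv : M v.
  move=> g Pg; have [Ng|nN] := pselect (N g); first exact: Nvu.
  have [h Hh cgh] : exists2 h, H h & ~ commute h g.
    apply: contrapT => nh; apply: nN; apply/normaliserP; split=> // h Hh.
    by apply: commute_sym; apply: contrapT => hg; apply: nh; exists h.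
  have [i hg] := pauli_comm d_gt0 prim (HP Hh) Pg.
  have : (1 - zeta ^+ (2 * i)) * inner (g v) u = 0.
    rewrite mulrBl mul1r -[X in X - _](pauli_unitary prim _ _ (HP Hh)) -glM hg.
    by rewrite -expgnA !glM !(Wv h Hh) (Wu h Hh) zeta_glE innerZl subrr.
  move/eqP; rewrite mulf_eq0 => /orP[|/eqP//]; rewrite subr_eq0 eq_sym => /eqP.
  move/(zeta_eq1 prim)/(zeta_gl_eq1 n d_gt0 prim) => z1; case: cgh.
  by rewrite /commute hg -expgnA z1 mul1g.
suff Mu : M u.
  apply: inner_eq0; rewrite -[X in inner X _](gl1 u); apply: Mu.
  exact: subgroup1 sgP.
apply: (pauli_irreducible prim _ _ Mv v0) => [a x y Mx My g Pg|g x Pg Mx h Ph].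
- by rewrite linearP innerDl innerZl Mx // My // mulr0 addr0.
- by rewrite -glM; apply: Mx; apply: subgroupM sgP Ph Pg.
Qed.

(** Let [v] in V^H be an eigenvector of [g], with eigenvalue [zeta ^+ j]. Since [g] is central, it
    acts by this scalar on the whole orbit of [v] under [N]; unitarity extends this to V^H. *)
Lemma normaliser_central g : N g -> (forall h, N h -> commute g h) ->
  exists i h, H h /\ (g = zt ^+ i * h)%g.
Proof.
move=> Ng cgN; have [w Ww w0] := fixed_by_neq0; have [Pg _] := (normaliserP g).1 Ng.
have [j [v [Wv v0 gv]]] := root_eigenvector prim (pauli_exponent d_gt0 prim Pg)
  fixed_by_linear (fun x => fixed_by_normaliser Ng) Ww w0.
exists j, ((zt ^+ j)^-1 * g)%g; split; last by rewrite mulVKg.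
apply: fix_fixed_by => [|x Wx].
  by apply: subgroupM sgP _ Pg; apply: subgroupV sgP (zeta_gl_pauli j).
suff gx : g x = (zt ^+ j)%g x by rewrite glM gx glK.
have Nzj := zeta_gl_normaliser j.
apply/eqP; rewrite -subr_eq0; apply/eqP.
apply: (normaliser_irreducible _ Wv v0) => [|h Nh].
  rewrite addrC -scaleN1r; apply: fixed_by_linear; exact: fixed_by_normaliser.
(* With [h = g * h'], the vector [h v] is both [g (h' v)] and [zt ^+ j] applied to [h' v], so its
   products with [g x] and with [zt ^+ j] applied to [x] both equal [inner (h' v) x]. *)
rewrite -[h](mulVKg g) glM; set h' := (g^-1 * h)%g.
have Nh' : N h'.
  apply: subgroupM subgroup_normaliser _ Nh.
  exact: subgroupV subgroup_normaliser Ng.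
have gh'v : g (h' v) = (zt ^+ j)%g (h' v).
  by rewrite -glM cgN // glM gv linearZ zeta_glE.
rewrite innerDr innerNr (pauli_unitary prim _ _ Pg) gh'v.
by rewrite (pauli_unitary prim _ _ (zeta_gl_pauli j)) subrr.
Qed.

End Stabilizer.

(** * Products of one-qudit Pauli groups *)

Section PauliFactors.
Variables (C : numClosedFieldType) (d : nat) (zeta : C).
Hypotheses (d_gt0 : (0 < d)%N) (prim : (dbar d).-primitive_root zeta).
Notation D := (dbar d).

Section OneQudit.
Variable d0 : nat.
Hypotheses (d0_d : (d0 %| d)%N).
Notation om := ((zeta ^+ 2) ^+ (d %/ d0)).
Notation P1 := (pauli1_ext d d0 zeta).
Implicit Types u : GL (hilb C 'I_d0).

Let root_sqr : divisor_root d d0 zeta ^+ 2 = om.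
Proof. by apply: divisor_root_sqr => //; apply/(xi_eq1 prim). Qed.

Lemma subgroup_pauli1_ext : subgroup P1. Proof. exact: subgroup_gen_subgroup. Qed.

Lemma pauli1_ext_min (S : set (GL (hilb C 'I_d0))) : subgroup S ->
  (forall u, gl_val u = shift_op d0 -> S u) ->
  (forall u, gl_val u = clock_op d0 om -> S u) ->
  (forall u i, gl_val u = scalar_op (zeta ^+ i) -> S u) -> P1 `<=` S.
Proof.
move=> sgS SX SZ Szeta; apply: subgroup_gen_min => // u [|uE]; last first.
  by apply: (Szeta _ 1%N).
apply: (subgroup_gen_min sgS) => {}u [uE|uE|uE].
- exact: SX.
- by apply: SZ; rewrite uE root_sqr.
- by move: uE; rewrite /divisor_root; case: odd => uE; apply: Szeta uE.
Qed.

Lemma pauli1_ext_shift u : gl_val u = shift_op d0 -> P1 u.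
Proof.
by move=> uE; apply: sub_subgroup_gen; left; apply: sub_subgroup_gen; constructor 1.
Qed.

Lemma pauli1_ext_clock u : gl_val u = clock_op d0 om -> P1 u.
Proof.
move=> uE; apply: sub_subgroup_gen; left; apply: sub_subgroup_gen; constructor 2.
by rewrite root_sqr.
Qed.

Lemma pauli1_ext_zeta u : gl_val u = scalar_op zeta -> P1 u.
Proof. by move=> uE; apply: sub_subgroup_gen; right. Qed.

Lemma pauli1_ext_monomial u : P1 u -> root_monomial zeta u.
Proof.
move: u; apply: pauli1_ext_min => [|u uE|u uE|u i uE].
- exact: subgroup_root_monomial (dbar_gt0 prim) (zeta_dbar prim).
- exists (@ordS d0), (fun=> 0%N); split=> [|t]; first exact: ordS_inj.
  by rewrite uE shift_op_basis scale1r.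
- exists id, (fun t : 'I_d0 => 2 * (d %/ d0) * t)%N; split=> // t.
  by rewrite uE clock_op_basis !exprM.
- by exists id, (fun=> i); split=> // t; rewrite uE scalar_opE.
Qed.

Lemma shift_gl1_inj : lker (shift_op d0 : 'End(hilb C 'I_d0)) == 0%VS.
Proof.
apply: (@monomial_inj _ _ _ (@ordS d0) (fun=> 1)) => [|t|s].
- exact: ordS_inj.
- exact: oner_neq0.
- by rewrite shift_op_basis scale1r.
Qed.

Lemma clock_gl1_inj : lker (clock_op d0 om : 'End(hilb C 'I_d0)) == 0%VS.
Proof.
apply: (@monomial_inj _ _ _ id (fun s : 'I_d0 => om ^+ s)) => [//|t|s].
- by rewrite !expf_neq0 // (zeta_neq0 prim).
- by rewrite clock_op_basis.
Qed.

End OneQudit.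

Variables (k : nat) (e : 'I_k -> nat) (i0 : 'I_k).
Hypotheses (e_gt0 : forall i, (0 < e i)%N) (e_d : forall i, (e i %| d)%N).
Notation F := {dffun forall i : 'I_k, GL (hilb C 'I_(e i))}.
Notation P := (pauli_factors e d zeta).
Notation K := (zeta_relations e zeta).
Implicit Types (h : F) (i j : 'I_k) (t s : multi_index e).

Definition factors_op h : 'End(hilb C (multi_index e)) :=
  tensor_op (fun i => gl_val (h i)).

Lemma factorsM h h' i : (h * h')%g i = (h i * h' i)%g. Proof. exact: ffunE. Qed.
Lemma factors1 i : (1 : F)%g i = 1%g. Proof. exact: ffunE. Qed.
Lemma factorsV h i : (h^-1)%g i = (h i)^-1%g. Proof. exact: ffunE. Qed.
Lemma factorsX h m i : (h ^+ m)%g i = (h i ^+ m)%g.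
Proof. by elim: m => [|m IHm]; rewrite ?factors1 // !expgS factorsM IHm. Qed.

Lemma factors_opM h h' :
  factors_op (h * h')%g = (factors_op h \o factors_op h')%VF.
Proof. by rewrite tensor_op_comp; apply: tensor_op_eq => i; rewrite factorsM. Qed.

Lemma factors_op_scalar (c : 'I_k -> C) h :
  (forall i, gl_val (h i) = scalar_op (c i)) -> factors_op h = scalar_op (\prod_i c i).
Proof.
by move=> hc; rewrite -tensor_op_scalar; apply: tensor_op_eq => i; rewrite hc.
Qed.

Lemma factors_op1 : factors_op 1%g = \1%VF.
Proof.
rewrite (@factors_op_scalar (fun=> 1)) => [|i]; last first.
  by rewrite factors1 /scalar_op scale1r.
by rewrite big1 // /scalar_op scale1r.
Qed.

Lemma subgroup_factors : subgroup P.
Proof.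
have sgP i := subgroup_pauli1_ext (e i).
split=> [i|h h' Ph Ph' i|h Ph i].
- by rewrite factors1; apply: subgroup1 (sgP i).
- by rewrite factorsM; apply: subgroupM (sgP i) (Ph i) (Ph' i).
- by rewrite factorsV; apply: subgroupV (sgP i) (Ph i).
Qed.

Definition zeta_factor i : GL (hilb C 'I_(e i)) :=
  MkGL (scalar_op_inj _ (zeta_neq0 prim)).

Lemma zeta_factorX i m : gl_val (zeta_factor i ^+ m)%g = scalar_op (zeta ^+ m).
Proof.
elim: m => [|m IHm]; first by rewrite /scalar_op scale1r.
rewrite expgS; apply/lfunP => v; rewrite /= comp_lfunE IHm !scalar_opE.
by rewrite scalerA exprS.
Qed.

Lemma zeta_factor_dbar i : (zeta_factor i ^+ D = 1)%g.
Proof.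
by apply: val_inj; rewrite /= zeta_factorX (zeta_dbar prim) /scalar_op scale1r.
Qed.

Lemma zeta_factor_ext i m : pauli1_ext d (e i) zeta (zeta_factor i ^+ m)%g.
Proof.
exact: subgroupX (subgroup_pauli1_ext _) (pauli1_ext_zeta _).
Qed.

Definition zeta_factors (m : 'I_k -> nat) : F :=
  [ffun i => (zeta_factor i ^+ m i)%g].

Lemma zeta_factorsD m m' :
  zeta_factors (fun i => m i + m' i)%N = (zeta_factors m * zeta_factors m')%g.
Proof. by apply/ffunP => i; rewrite factorsM !ffunE expgnDr. Qed.

Lemma zeta_factorsX m l : zeta_factors (fun i => l * m i)%N = (zeta_factors m ^+ l)%g.
Proof. by apply/ffunP => i; rewrite factorsX !ffunE mulnC expgnA. Qed.

Lemma zeta_inv : zeta^-1 = zeta ^+ D.-1.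
Proof.
apply: (mulfI (zeta_neq0 prim)); rewrite mulfV ?(zeta_neq0 prim) // -exprS.
by rewrite prednK ?(dbar_gt0 prim) // (zeta_dbar prim).
Qed.

Lemma subgroup_relations : subgroup K. Proof. exact: subgroup_gen_subgroup. Qed.

(* [zeta^-1] is written [zeta ^+ D.-1] to keep the exponents in [nat]. *)
Lemma zeta_pair_relations i :
  K (zeta_factors (fun j => (j == i) + (j == i0) * D.-1)%N).
Proof.
have [->|ii0] := eqVneq i i0.
  suff -> : zeta_factors (fun j => (j == i0) + (j == i0) * D.-1)%N = 1%g.
    exact: subgroup1 subgroup_relations.
  apply/ffunP => j; rewrite factors1 ffunE; case: eqP => // _.
  by rewrite mul1n add1n prednK ?(dbar_gt0 prim) // zeta_factor_dbar.
apply: sub_subgroup_gen; exists i, i0; split=> //.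
- by rewrite ffunE eqxx (negPf ii0) zeta_factorX.
- by rewrite ffunE eqxx eq_sym (negPf ii0) zeta_factorX add0n mul1n zeta_inv.
- by move=> l /negPf li /negPf li0; rewrite ffunE li li0.
Qed.

(** The scalars are moved one by one into the factor [i0], where their product is 1. *)
Lemma zeta_factors_relations m :
  \prod_i zeta ^+ m i = 1 -> K (zeta_factors m).
Proof.
move=> m1; have sgK := subgroup_relations.
(* Once the factors in [r] are treated, [i0] carries in addition the inverse of the product of their
   scalars. *)
have Kr (r : seq 'I_k) : uniq r -> K (zeta_factors (fun j =>
    (j \in r) * m j + (j == i0) * (D.-1 * \sum_(i <- r) m i))%N).
  elim: r => [_|i r IHr /= /andP[ir /IHr Kr]].
    suff -> : zeta_factors (fun j => (j \in [::]) * m j +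
        (j == i0) * (D.-1 * \sum_(i <- [::]) m i))%N = 1%g by apply: subgroup1.
    by apply/ffunP => j; rewrite factors1 ffunE big_nil !muln0.
  have := subgroupM sgK Kr (subgroupX (m i) sgK (zeta_pair_relations i)).
  rewrite -zeta_factorsX -zeta_factorsD; congr (K _); apply/ffunP => j; rewrite !ffunE.
  congr (_ ^+ _)%g; rewrite big_cons inE; case: (eqVneq j i) => [->|_] /=.
    by rewrite (negPf ir) /=; case: (i == i0) => /=; lia.
  by case: (j == i0) => /=; lia.
have := Kr (enum 'I_k) (enum_uniq _); congr (K _); apply/ffunP => j; rewrite !ffunE.
rewrite mem_enum mul1n expgnDr; have -> : (zeta_factor j ^+
    ((j == i0) * (D.-1 * \sum_(i <- enum 'I_k) m i)) = 1)%g; last by rewrite mulg1.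
apply: val_inj; rewrite /= zeta_factorX mulnA mulnC exprM -prodrXr.
by rewrite big_enum /= m1 expr1n /scalar_op scale1r.
Qed.

Lemma relations_factors h : K h -> P h /\ factors_op h = \1%VF.
Proof.
move: h; apply: (@subgroup_gen_min _ _ [set h | P h /\ factors_op h = \1%VF]).
  have sgP := subgroup_factors; split=> [|h h' [Ph h1] [Ph' h'1]|h [Ph h1]].
  - by split; [exact: subgroup1 sgP | apply: factors_op1].
  - split; first exact: subgroupM sgP Ph Ph'.
    by rewrite /= factors_opM h1 h'1 comp_lfun1l.
  - split; first exact: subgroupV sgP Ph.
    by rewrite /= -[LHS]comp_lfun1r -h1 -factors_opM mulVg factors_op1.
move=> h [i [j [ij hi hj hl]]]; split.
  move=> l; have [->|li] := eqVneq l i; first exact: pauli1_ext_zeta.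
  have [->|lj] := eqVneq l j; last first.
    by rewrite hl //; exact: subgroup1 (subgroup_pauli1_ext _).
  have -> : h j = (zeta_factor j ^+ D.-1)%g.
    by apply: val_inj; rewrite /= hj zeta_factorX zeta_inv.
  exact: zeta_factor_ext.
rewrite (@factors_op_scalar
  (fun l => if l == i then zeta else if l == j then zeta^-1 else 1)).
  rewrite (bigD1 i) //= (bigD1 j) //=; last by rewrite eq_sym.
  rewrite eqxx eqxx [j == i]eq_sym (negPf ij) big1 ?mulr1; last first.
    by move=> l /andP[/negPf-> /negPf->].
  by rewrite mulfV ?(zeta_neq0 prim) // /scalar_op scale1r.
move=> l; case: eqP => [->//|/eqP li]; case: eqP => [->//|/eqP lj].
by rewrite hl // /scalar_op scale1r.
Qed.

Let s0 : multi_index e := [ffun i => Ordinal (e_gt0 i)].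
Let at_ i (a : 'I_(e i)) : multi_index e := [ffun j => dfwith s0 a j].

(** Freeze all indices but the [i]-th at [s0]: the matrix of [h i] times a constant [r] is then the
    identity matrix, so [r] is nonzero and [h i] is [r^-1]. *)
Lemma factors_scalar h i : factors_op h = \1%VF ->
  exists c, forall a, h i (basis_vec a) = c *: basis_vec a.
Proof.
move=> h1.
have hE s t : \prod_j h j (basis_vec (s j)) (t j) = (t == s)%:R.
  transitivity (factors_op h (basis_vec s) t); first by rewrite op_mx_basis.
  by rewrite h1 id_lfunE ffunE.
pose r := \prod_(j | j != i) h j (basis_vec (s0 j)) (s0 j).
have split_i (a b : 'I_(e i)) : h i (basis_vec a) b * r = (b == a)%:R.
  transitivity ((at_ b == at_ a)%:R : C); last first.
    suff -> : (at_ b == at_ a) = (b == a) by [].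
    by apply/eqP/eqP => [/ffunP/(_ i)|->//]; rewrite !ffunE !dfwith_in.
  rewrite -hE (bigD1 i) //= !ffunE !dfwith_in; congr (_ * _).
  by apply: eq_bigr => j; rewrite eq_sym => ij; rewrite !ffunE !dfwith_out // !ffunE.
exists r^-1 => a; apply/ffunP => b; rewrite !ffunE.
have r0 : r != 0.
  apply/eqP => r0; have := split_i (s0 i) (s0 i); rewrite r0 mulr0 eqxx.
  by move/eqP; rewrite eq_sym oner_eq0.
by rewrite -(split_i a b) [X in _ = X]mulrC mulfK.
Qed.

(** Faithfulness of the central product on the tensor product: an [h] acting trivially consists of
    scalars, which are powers of [zeta] with product 1. *)
Lemma factors_relations h : P h -> (factors_op h = \1%VF <-> K h).
Proof.
move=> Ph; split=> [h1|/relations_factors[]//].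
have hE i : exists m, h i = (zeta_factor i ^+ m)%g.
  have [c hc] := factors_scalar i h1.
  have [m cm] := root_monomial_scalar (Ordinal (e_gt0 i)) (zeta_neq0 prim)
    (pauli1_ext_monomial (e_d i) (Ph i)) hc.
  exists m; apply: gl_basisP => t.
  by rewrite hc zeta_factorX scalar_opE cm.
have [m hm] := choice hE.
have -> : h = zeta_factors m by apply/ffunP => i; rewrite ffunE hm.
apply: zeta_factors_relations.
have := h1; rewrite (@factors_op_scalar (fun i => zeta ^+ m i)) => [|i]; last first.
  by rewrite hm zeta_factorX.
move=> /lfunP/(_ (basis_vec s0)); rewrite scalar_opE id_lfunE => /ffunP/(_ s0).
by rewrite !ffunE eqxx /GRing.scale /= mulr1.
Qed.

End PauliFactors.

(** * Hyperbolic coordinates on the stabilised subspace *)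

Section HyperbolicCoordinates.
Variables (C : numClosedFieldType) (n d : nat) (zeta : C).
Hypotheses (d_gt0 : (0 < d)%N) (prim : (dbar d).-primitive_root zeta).
Notation D := (dbar d).
Notation V := (qudits C n d).
Notation P := (pauli n d zeta).
Notation zt := (zeta_gl n prim).
Notation xi := (zt ^+ 2)%g.
Variable H : set (GL V).
Hypotheses (sgH : subgroup H) (HP : H `<=` P) (cH : commutative_set H).
Hypothesis H_zt : forall i, H (zt ^+ i)%g -> (zt ^+ i)%g = 1%g.
Notation W := (fixed_by H).
Notation N := (normaliser_in P H).
Variables (k : nat) (e : 'I_k -> nat) (x z : 'I_k -> GL V) (i0 : 'I_k).
Hypotheses (e_gt0 : forall i, (0 < e i)%N) (e_d : forall i, (e i %| d)%N).
Hypotheses (Nx : forall i, N (x i)) (Nz : forall i, N (z i)).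
Hypotheses (Hx : forall i, H (x i ^+ e i)%g) (Hz : forall i, H (z i ^+ e i)%g).
Hypothesis zx : forall i, comm_exp xi (z i) (x i) (d %/ e i).
Hypotheses (xxC : forall i j, commute (x i) (x j)).
Hypotheses (zzC : forall i j, commute (z i) (z j)).
Hypotheses (zxC : forall i j, i != j -> commute (z i) (x j)).
Hypothesis N_gen : forall S : set (GL V), subgroup S -> S zt -> H `<=` S ->
  (forall i, S (x i) /\ S (z i)) -> N `<=` S.
Implicit Types (i j : 'I_k) (t s : multi_index e) (f : 'I_k -> nat).

Definition pair_root i : C := (zeta ^+ 2) ^+ (d %/ e i).
Notation om := pair_root.

Lemma pair_root_prim i : (e i).-primitive_root (om i).
Proof. by have := dvdn_prim_root (xi_prim prim) (e_d i). Qed.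

Let sgP : subgroup P := @subgroup_pauli C n d zeta.
Let sgN : subgroup N := subgroup_normaliser d_gt0 sgH HP H_zt.
Let NP g : N g -> P g. Proof. by case. Qed.

Let gl_inj0 (g : GL V) v : v != 0 -> g v != 0.
Proof. by apply: contra => /eqP gv; rewrite -(glK g v) gv linear0. Qed.

Let WN g v : N g -> W v -> W (g v).
Proof. exact: (fixed_by_normaliser d_gt0 sgH HP H_zt). Qed.

Lemma clock_fixed_vector : exists w, [/\ W w, inner w w = 1 & forall i, z i w = w].
Proof.
suff [w [Ww w0 zw]] : exists w, [/\ W w, w != 0 & forall i, z i w = w].
  have w_gt0 := inner_gt0 w0; exists ((sqrtC (inner w w))^-1 *: w); split=> [||i].
  - by rewrite -[_ *: _]addr0; apply: fixed_by_linear => // h _; rewrite linear0.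
  - rewrite innerZl innerZr geC0_conj ?invr_ge0 ?sqrtC_ge0 ?ltW //.
    rewrite mulrA -expr2 exprVn sqrtCK mulVf //; exact: lt0r_neq0.
  - by rewrite linearZ /= zw.
suff: forall r : seq 'I_k, exists w,
    [/\ W w, w != 0 & forall i, i \in r -> z i w = w].
  case/(_ (enum 'I_k)) => w [Ww w0 zw].
  by exists w; split=> // i; rewrite zw ?mem_enum.
elim=> [|i r [w [Ww w0 zw]]].
  by have [w Ww w0] := fixed_by_neq0 d_gt0 sgH HP H_zt; exists w.
have [ir|/negP ir] := boolP (i \in r).
  by exists w; split=> // j; rewrite inE => /orP[/eqP->|]; apply: zw.
(* The eigenvector of [z i] is sought among vectors already fixed by the earlier [z j]; [z i]
   preserves this space because it commutes with them. *)
pose Wr v := W v /\ forall j, j \in r -> z j v = v.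
have [a u v [Wu zu] [Wv zv]|u [Wu zu]|//|//|j [u [[Wu zu] u0 iu]]] :=
  @root_eigenvector C _ D zeta Wr (z i) w prim (pauli_exponent d_gt0 prim (NP (Nz i))).
- split=> [|j jr]; first exact: fixed_by_linear.
  by rewrite linearP /= zu ?zv.
- split=> [|j jr]; first exact: WN.
  by rewrite -glM zzC glM zu.
(* Since [z i ^+ e i] lies in [H], it fixes [u], so the eigenvalue is an [e i]-th root of unity, a
   power [om i ^+ l]. *)
have zeta_e : (zeta ^+ j) ^+ e i = 1.
  have ziX m : (z i ^+ m)%g u = (zeta ^+ j) ^+ m *: u.
    elim: m => [|m IHm]; first by rewrite gl1 scale1r.
    by rewrite expgS glM IHm linearZ /= iu scalerA -exprSr.
  have := Wu _ (Hz i); rewrite ziX => /eqP; rewrite -subr_eq0 -{2}[u]scale1r.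
  by rewrite -scalerBl scaler_eq0 (negPf u0) orbF subr_eq0 => /eqP.
have [l zl] := prim_rootP (pair_root_prim i) zeta_e.
(* Each [x i] multiplies the eigenvalue of [z i] by [om i], so [e i - l] of them bring [om i ^+ l]
   to 1; the other [z m] commute with [x i]. *)
pose g := (x i ^+ (e i - l))%g; have Ng : N g by apply: subgroupX.
exists (g u); split; [exact: WN | exact: gl_inj0 |].
move=> m; rewrite inE; case: (eqVneq m i) => [->|mi] /= mr; last first.
  by rewrite -glM (commuteX _ (zxC mi)) glM zu.
have zg := comm_expXr (@xi_gl_central _ n _ _ prim) (e i - l) (zx i).
rewrite -glM zg -expgnA !glM zeta_glE iu !linearZ /= scalerA zl.
have -> : zeta ^+ (2 * ((e i - l) * (d %/ e i))) = om i ^+ (e i - l).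
  by rewrite /pair_root [((e i - l) * _)%N]mulnC -!exprM mulnA.
by rewrite -exprD subnKC ?(prim_expr_order (pair_root_prim i)) ?scale1r // ltnW.
Qed.

(** The exponents are not reduced modulo [e i], so that words multiply by adding them; reduction is
    valid only on V^H. *)
Definition shift_word f : GL V := (\prod_(i < k) x i ^+ f i)%g.

Lemma shift_wordD f f' :
  shift_word (fun i => f i + f' i)%N = (shift_word f * shift_word f')%g.
Proof.
rewrite -prodgM_commute => [|i j _ _]; last by apply: commuteX2; apply: xxC.
by apply: eq_bigr => i _; rewrite expgnDr.
Qed.

Lemma shift_word_eq f f' : f =1 f' -> shift_word f = shift_word f'.
Proof. by move=> ff'; apply: eq_bigr => i _; rewrite ff'. Qed.

Lemma shift_word1 i : shift_word (fun j => (j == i) : nat) = x i.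
Proof.
rewrite /shift_word (big_only1 i) ?eqxx // => j /negPf ji _.
by rewrite ji.
Qed.

Lemma shift_word_normaliser f : N (shift_word f).
Proof.
rewrite /shift_word; elim/big_ind: _ => [|g h|i _].
- exact: subgroup1 sgN.
- exact: subgroupM sgN.
- exact: subgroupX sgN (Nx i).
Qed.

Lemma shift_word_fixed f v : W v -> (forall i, (e i %| f i)%N) ->
  shift_word f v = v.
Proof.
move=> Wv ef; apply: Wv; rewrite /shift_word; elim/big_ind: _ => [|g h|i _].
- exact: subgroup1 sgH.
- exact: subgroupM sgH.
- by have /dvdnP[q ->] := ef i; rewrite mulnC expgnA; apply: subgroupX.
Qed.

Lemma clock_shift_word i f :
  comm_exp xi (z i) (shift_word f) (f i * (d %/ e i))%N.
Proof.
have -> : (f i * (d %/ e i) = \sum_(j < k) if j == i then f j * (d %/ e j) else 0)%N.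
  by rewrite -big_mkcond big_pred1_eq.
apply: (comm_exp_prod (@xi_gl_central _ n _ _ prim)) => j.
case: eqP => [->|/eqP ji]; first by apply: comm_expXr (zx i); apply: xi_gl_central.
by apply/comm_exp0/commuteX/zxC; rewrite eq_sym.
Qed.

Section Frame.
Variable w0 : V.
Hypotheses (Ww0 : W w0) (w0_unit : inner w0 w0 = 1) (zw0 : forall i, z i w0 = w0).

Definition frame t : V := shift_word (fun i => t i) w0.

Lemma frame_fixed t : W (frame t).
Proof. exact: WN (shift_word_normaliser _) Ww0. Qed.

Lemma frame_shift i t : x i (frame t) = frame (shift_at i t).
Proof.
rewrite /frame -glM -(shift_word1 i) -shift_wordD.
(* The added multiple of [e j] is the carry when coordinate [i] wraps around, and 0 otherwise; its
   word lies in [H] and fixes [w0]. *)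
rewrite (@shift_word_eq _ (fun j => ((shift_at i t) j +
    ((j == i) + t j) %/ e j * e j)%N)) => [|j].
  rewrite shift_wordD glM; congr (gl_val _ _).
  by apply: shift_word_fixed => // j; rewrite dvdn_mull.
rewrite ffunE [RHS]addnC [LHS](divn_eq _ (e j)); congr (_ + _)%N.
case: eqP => [_|_] /=; first by rewrite add1n.
by rewrite add0n modn_small.
Qed.

Lemma frame_clock i t : z i (frame t) = om i ^+ t i *: frame t.
Proof.
rewrite -glM (clock_shift_word i) -expgnA !glM zeta_glE zw0; congr (_ *: _).
by rewrite /pair_root -!exprM mulnA mulnAC -mulnA [(_ %/ _ * _)%N]mulnC mulnA.
Qed.

(** Indices that differ at [i] give different eigenvalues of the unitary [z i]; the norms are 1
    because shift words are unitary. *)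
Lemma frame_orthonormal t s : inner (frame t) (frame s) = (t == s)%:R.
Proof.
have [->|ts] := eqVneq t s.
  by rewrite (pauli_unitary prim _ _ (NP (shift_word_normaliser _))).
have [i tsi] := multi_index_neq ts.
have om1 : om i * (om i)^* = 1.
  have := pair_root_prim i; move: (om i) => o o_prim.
  have /eqP o1 : `|o| == 1.
    rewrite -(pexpr_eq1 (e_gt0 i)) // -normrX (prim_expr_order o_prim).
    by rewrite normr1.
  by rewrite -normCK o1 expr1n.
have : (1 - om i ^+ t i * (om i ^+ s i)^*) * inner (frame t) (frame s) = 0.
  rewrite mulrBl mul1r -[X in X - _](pauli_unitary prim _ _ (NP (Nz i))).
  by rewrite !frame_clock innerZl innerZr mulrA subrr.
move/eqP; rewrite mulf_eq0 => /orP[|/eqP//]; rewrite subr_eq0 => /eqP.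
move=> /(congr1 ( *%R^~ (om i ^+ s i))); rewrite mul1r -mulrA [X in _ * X]mulrC.
rewrite rmorphXn /= -exprMn om1 expr1n mulr1 => /esym/eqP.
rewrite (eq_prim_root_expr (pair_root_prim i)) !modn_small // => /eqP/val_inj.
by move=> tsi'; rewrite tsi' eqxx in tsi.
Qed.

Definition frame_sum (v : hilb C (multi_index e)) : V := \sum_t v t *: frame t.

Lemma frame_sum_linear : linear frame_sum.
Proof.
move=> a u v; rewrite scaler_sumr -big_split; apply: eq_bigr => t _ /=.
by rewrite !ffunE scalerDl scalerA.
Qed.

HB.instance Definition _ :=
  GRing.isLinear.Build C (hilb C (multi_index e)) V _ frame_sum frame_sum_linear.

Definition frame_map : 'Hom(hilb C (multi_index e), V) := linfun frame_sum.
Notation U := frame_map.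

Lemma frame_mapE v : U v = \sum_t v t *: frame t. Proof. by rewrite lfunE. Qed.

Lemma frame_map_basis t : U (basis_vec t) = frame t.
Proof.
rewrite frame_mapE (bigD1 t) //= big1 => [|s /negPf st].
  by rewrite ffunE eqxx scale1r addr0.
by rewrite ffunE st scale0r.
Qed.

Lemma frame_map_fixed v : W (U v).
Proof.
rewrite frame_mapE; apply: big_ind => [h _|u w Wu Ww|t _].
- by rewrite linear0.
- by rewrite -[u]scale1r; apply: fixed_by_linear.
- rewrite -[_ *: _]addr0; apply: fixed_by_linear; first exact: frame_fixed.
  by move=> h _; rewrite linear0.
Qed.

Lemma frame_map_inner_frame v t : inner (U v) (frame t) = v t.
Proof.
rewrite frame_mapE inner_suml (bigD1 t) //= big1 => [|s st].
  by rewrite innerZl frame_orthonormal eqxx mulr1 addr0.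
by rewrite innerZl frame_orthonormal (negPf st) mulr0.
Qed.

Lemma frame_map_isometry u v : inner (U u) (U v) = inner u v.
Proof.
rewrite [X in inner _ X]frame_mapE inner_sumr; apply: eq_bigr => t _.
by rewrite innerZr frame_map_inner_frame mulrC.
Qed.

Lemma frame_map_inj : injective U.
Proof.
move=> u v uv; apply/ffunP => t.
by rewrite -[LHS]frame_map_inner_frame uv frame_map_inner_frame.
Qed.

Notation F := {dffun forall i : 'I_k, GL (hilb C 'I_(e i))}.
Notation Pf := (pauli_factors e d zeta).
Notation K := (zeta_relations e zeta).
Implicit Types (g : GL V) (h : F).

(** This is the relation supplied to [quotient_iso_rel]; the compatibility of the two actions is
    then part of the construction. *)
Definition intertwined g h := forall v, g (U v) = U (factors_op h v).

Lemma intertwined_basis g h :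
  (forall t, g (frame t) = U (factors_op h (basis_vec t))) -> intertwined g h.
Proof.
move=> gh v; rewrite -[LHS]comp_lfunE -[RHS]comp_lfunE; congr (fun_of_lfun _ v).
by apply: lfun_basisP => t; rewrite !comp_lfunE frame_map_basis gh.
Qed.

Lemma intertwinedM g g' h h' :
  intertwined g h -> intertwined g' h' -> intertwined (g * g')%g (h * h')%g.
Proof. by move=> gh gh' v; rewrite glM gh' gh factors_opM comp_lfunE. Qed.

Lemma intertwinedV g h : intertwined g h -> intertwined g^-1%g h^-1%g.
Proof.
move=> gh v; rewrite -[RHS](glK g) gh -comp_lfunE -factors_opM mulgV factors_op1.
by rewrite id_lfunE.
Qed.

Lemma intertwined1 : intertwined 1%g 1%g.
Proof. by move=> v; rewrite gl1 factors_op1 id_lfunE. Qed.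

Definition embed i (u : GL (hilb C 'I_(e i))) : F :=
  [ffun j => dfwith (fun j => 1%g : GL (hilb C 'I_(e j))) u j].

Lemma embed_op i (u : GL (hilb C 'I_(e i))) (A : forall j, 'End(hilb C 'I_(e j))) :
  gl_val u = A i ->
  factors_op (embed u) = tensor_op (fun j => if j == i then A j else \1%VF).
Proof.
move=> uA; apply: tensor_op_eq => j; rewrite ffunE; case: dfwithP.
  by rewrite eqxx.
by move=> l il; rewrite eq_sym (negPf il).
Qed.

Lemma intertwined_shift i (u : GL (hilb C 'I_(e i))) :
  gl_val u = shift_op (e i) -> intertwined (x i) (embed u).
Proof.
move=> uE; apply: intertwined_basis => t.
rewrite (@embed_op _ _ (fun j => shift_op (e j)) uE) frame_shift.
by rewrite -frame_map_basis -shift_op_atE.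
Qed.

Lemma intertwined_clock i (u : GL (hilb C 'I_(e i))) :
  gl_val u = clock_op (e i) (om i) -> intertwined (z i) (embed u).
Proof.
move=> uE; apply: intertwined_basis => t.
rewrite (@embed_op _ _ (fun j => clock_op (e j) (om i)) uE) frame_clock.
by rewrite [tensor_op _ _]clock_op_atE linearZ /= frame_map_basis.
Qed.

Lemma intertwined_zeta i m (u : GL (hilb C 'I_(e i))) :
  gl_val u = scalar_op (zeta ^+ m) -> intertwined (zt ^+ m)%g (embed u).
Proof.
move=> uE v; rewrite zeta_glE.
rewrite (@factors_op_scalar _ _ _ (fun j => if j == i then zeta ^+ m else 1)).
  by rewrite -big_mkcond big_pred1_eq scalar_opE linearZ.
move=> j; rewrite ffunE; case: dfwithP => [|l il]; first by rewrite eqxx.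
by rewrite eq_sym (negPf il) /scalar_op scale1r.
Qed.

Lemma embedM i (u v : GL (hilb C 'I_(e i))) :
  embed (u * v)%g = (embed u * embed v)%g.
Proof.
apply/ffunP => j; rewrite factorsM !ffunE.
have [<-|ij] := eqVneq i j; first by rewrite !dfwith_in.
by rewrite !dfwith_out // mulg1.
Qed.

Lemma embed_factor i (u : GL (hilb C 'I_(e i))) :
  pauli1_ext d (e i) zeta u -> Pf (embed u).
Proof.
move=> Pu j; rewrite ffunE; case: dfwithP => // l _.
exact: subgroup1 (subgroup_pauli1_ext _ _ _).
Qed.

Lemma normaliser_intertwined g : N g -> exists2 h, Pf h & intertwined g h.
Proof.
have sgF := subgroup_factors d zeta e.
move: g; apply: (N_gen (S := [set g | exists2 h, Pf h & intertwined g h])).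
- split=> [|g g' [h Ph gh] [h' Ph' gh']|g [h Ph gh]].
  + by exists 1%g; [exact: subgroup1 sgF | exact: intertwined1].
  + by exists (h * h')%g; [exact: subgroupM sgF Ph Ph' | exact: intertwinedM].
  + by exists h^-1%g; [exact: subgroupV sgF Ph | exact: intertwinedV].
(* The scalar [zt] must be carried by some factor; [i0] exists because the list of pairs is
   nonempty. *)
- exists (embed (zeta_factor prim e i0)).
    by apply: embed_factor; apply: pauli1_ext_zeta.
  exact: (@intertwined_zeta i0 1%N).
- move=> g Hg; exists 1%g; first exact: subgroup1 sgF.
  by move=> v; rewrite factors_op1 id_lfunE; apply: frame_map_fixed.
- move=> i; split.
    exists (embed (MkGL (shift_gl1_inj C (e i)))); last exact: intertwined_shift.
    by apply: embed_factor; apply: pauli1_ext_shift.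
  exists (embed (MkGL (clock_gl1_inj prim (e i)))); last exact: intertwined_clock.
  by apply: embed_factor; apply: pauli1_ext_clock.
Qed.

Lemma embed_intertwined i (u : GL (hilb C 'I_(e i))) :
  pauli1_ext d (e i) zeta u -> exists2 g, N g & intertwined g (embed u).
Proof.
have embedV (v : GL (hilb C 'I_(e i))) : embed v^-1%g = (embed v)^-1%g.
  apply/esym/mulg1_eq; rewrite -embedM mulgV; apply/ffunP => j; rewrite ffunE factors1.
  by case: dfwithP.
move: u; apply: (pauli1_ext_min prim (e_d i)
  (S := [set u | exists2 g, N g & intertwined g (embed u)])).
- split=> [|u v [g Ng gu] [h Nh hv]|u [g Ng gu]] /=.
  + exists 1%g; first exact: subgroup1 sgN.
    suff -> : embed (1 : GL (hilb C 'I_(e i)))%g = 1%g by exact: intertwined1.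
    by apply/ffunP => j; rewrite ffunE factors1; case: dfwithP.
  + exists (g * h)%g; first exact: subgroupM sgN Ng Nh.
    by rewrite embedM; apply: intertwinedM.
  + exists g^-1%g; first exact: subgroupV sgN Ng.
    by rewrite embedV; apply: intertwinedV.
- by move=> u uE; exists (x i) => //; apply: intertwined_shift.
- by move=> u uE; exists (z i) => //; apply: intertwined_clock.
- move=> u m uE; exists (zt ^+ m)%g; last exact: intertwined_zeta.
  exact: (zeta_gl_normaliser d_gt0 sgH HP H_zt).
Qed.

Lemma factors_intertwined h : Pf h -> exists2 g, N g & intertwined g h.
Proof.
move=> Ph; pose cut (r : seq 'I_k) : F :=
  [ffun j => if j \in r then h j else 1%g].
suff cutP r : exists2 g, N g & intertwined g (cut r).
  suff -> : h = cut (enum 'I_k) by apply: cutP.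
  by apply/ffunP => j; rewrite ffunE mem_enum.
elim: r => [|i r [g Ng gr]].
  exists 1%g; first exact: subgroup1 sgN.
  suff -> : cut [::] = (1 : F)%g by exact: intertwined1.
  by apply/ffunP => j; rewrite !ffunE.
have [ir|ir] := boolP (i \in r).
  exists g => //; suff -> : cut (i :: r) = cut r by [].
  by apply/ffunP => j; rewrite !ffunE inE; case: eqP => [->|]; rewrite ?ir.
have [g' Ng' g'i] := embed_intertwined (Ph i).
exists (g' * g)%g; first exact: subgroupM sgN Ng' Ng.
suff -> : cut (i :: r) = (embed (h i) * cut r)%g by apply: intertwinedM.
apply/ffunP => j; rewrite factorsM !ffunE inE.
have [->|ji] := eqVneq j i; first by rewrite dfwith_in (negPf ir) mulg1.
by rewrite dfwith_out 1?eq_sym // mul1g.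
Qed.

(** For [y] in V^H, [y] minus its projection onto the span of the frame is orthogonal to the range
    of [U]. As [N] preserves that range, the difference is orthogonal to the orbit of a frame vector
    under [N], hence zero. *)
Lemma frame_map_range : range U = W.
Proof.
apply/seteqP; split=> [_ [v _ <-]|y Wy]; first exact: frame_map_fixed.
pose v : hilb C (multi_index e) := [ffun t => inner y (frame t)].
exists v => //; apply/esym/eqP; rewrite -subr_eq0; apply/eqP.
pose t0 : multi_index e := [ffun i => Ordinal (e_gt0 i)].
have t0_neq0 : frame t0 != 0.
  apply/eqP => ft; have := frame_orthonormal t0 t0; rewrite ft inner0l eqxx.
  by move/eqP; rewrite eq_sym oner_eq0.
apply: (normaliser_irreducible d_gt0 sgH HP H_zt _ (frame_fixed t0) t0_neq0).
  by rewrite addrC -scaleN1r; apply: fixed_by_linear => //; apply: frame_map_fixed.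
move=> g Ng; have [h Ph gh] := normaliser_intertwined Ng.
rewrite -frame_map_basis gh; move: (factors_op h _) => u.
rewrite innerDr innerNr frame_map_isometry frame_mapE inner_suml; apply/eqP.
rewrite subr_eq0; apply/eqP; apply: eq_bigr => t _.
by rewrite innerZl ffunE -inner_conj.
Qed.

Lemma frame_quotient_iso : exists phi,
  quotient_iso N H Pf K phi /\
  forall g h v, N g -> Pf h -> phi (left_coset g H) = left_coset h K ->
    g (U v) = U (factors_op h v).
Proof.
have sgF := subgroup_factors d zeta e.
have sgK := subgroup_relations zeta e.
have HN := sub_normaliser d_gt0 sgH HP cH H_zt.
have KP : K `<=` Pf by move=> h /(relations_factors prim)[].
have gW g : N g -> (intertwined g 1%g <-> H g).
  move=> Ng; split=> [g1|Hg v].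
    apply: (fix_fixed_by d_gt0 sgH HP H_zt (NP Ng)) => y.
    by rewrite -frame_map_range => -[v _ <-]; rewrite g1 factors_op1 id_lfunE.
  by rewrite factors_op1 id_lfunE; apply: frame_map_fixed.
have hK h : Pf h -> (intertwined 1%g h <-> K h).
  move=> Ph; rewrite -(factors_relations d_gt0 prim i0 e_gt0 e_d Ph).
  split=> [h1|h1 v]; last by rewrite gl1 h1 id_lfunE.
  by apply/lfunP => v; apply: frame_map_inj; rewrite -h1 gl1 id_lfunE.
exists (rel_image Pf intertwined); split.
  exact: (quotient_iso_rel sgN sgH sgF sgK HN KP normaliser_intertwined
    factors_intertwined intertwinedM intertwinedV gW hK).
move=> g h v Ng Ph gh.
exact: (rel_of_image sgH sgK HN intertwinedM gW Ng Ph gh).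
Qed.

End Frame.
End HyperbolicCoordinates.

Theorem theorem2 (R : realType) (d n : nat) (zeta : R[i])
    (H : set (GL (qudits R[i] n d))) :
  (0 < d)%N -> (0 < n)%N ->
  (dbar d).-primitive_root zeta ->
  subgroup H -> H `<=` pauli n d zeta -> commutative_set H ->
  H `&` [set g | exists a : int, gl_val g = scalar_op (zeta ^ a)] = [set 1%g] ->
  exists s : seq nat,
    (forall d0, d0 \in s -> (0 < d0)%N /\ (d0 %| d)%N) /\
    let e := dims_of (factor_dims s) in
    let N := normaliser_in (pauli n d zeta) H in
    let P := pauli_factors e d zeta in
    let K := zeta_relations e zeta in
    exists (U : 'Hom(hilb R[i] (multi_index e), qudits R[i] n d))
           (phi : set (GL (qudits R[i] n d)) ->
                  set {dffun forall i, GL (hilb R[i] 'I_(e i))}),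
      [/\ unitary_onto U (fixed_by H),
          quotient_iso N H P K phi
        & forall g h w, N g -> P h -> phi (left_coset g H) = left_coset h K ->
            g (U w) = U (tensor_op (fun i => gl_val (h i)) w)].
Proof.
move=> d_gt0 _ prim sgH HP cH H_scalar.
pose zt : GL (qudits R[i] n d) := zeta_gl n prim.
have H_zt m : H (zt ^+ m)%g -> (zt ^+ m)%g = 1%g.
  move=> Hm; suff: [set 1%g] (zt ^+ m)%g by [].
  rewrite -H_scalar; split=> //; exists m%:Z.
  by apply/lfunP => v; rewrite zeta_glE scalar_opE.
have [g_seq g_seqP] := pauli_finite n prim.
have sgN := subgroup_normaliser d_gt0 sgH HP H_zt.
have NP g : normaliser_in (pauli n d zeta) H g -> pauli n d zeta g by case.
have HN := sub_normaliser d_gt0 sgH HP cH H_zt.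
have [|||g h Ng Nh|g Ng|g h Hg Nh||ts [ts0 tsP ts_orth ts_gen]] :=
  @hyperbolic_pairs _ zt d (dbar d) H d_gt0 (dbar_gt0 prim) (dvdn_dbar d)
    (zeta_gl_central prim) (zeta_gl_eq1 n d_gt0 prim) (xi_gl_eq1 n d_gt0 prim)
    sgH H_zt g_seq (normaliser_in (pauli n d zeta) H) sgN.
- by move=> g /NP; apply: g_seqP.
- by have := zeta_gl_normaliser d_gt0 sgH HP H_zt 1.
- exact: HN.
- by apply: (pauli_comm d_gt0); apply: NP.
- exact: pauli_exponent (NP _ Ng).
- have [_ ch] := (normaliserP d_gt0 sgH HP H_zt h).1 Nh.
  exact/commute_sym/ch.
- by move=> g Ng cg; apply: (normaliser_central d_gt0 sgH HP H_zt).
exists [seq t.1.1 | t <- ts]; split=> [d0 /mapP[t /tsP[t_d _ _ _ _] ->]|].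
  by split=> //; apply: dvdn_gt0 t_d.
(* The list is nonempty; if [N] is commutative it is the single dimension 1. *)
have -> : factor_dims [seq t.1.1 | t <- ts] = [seq t.1.1 | t <- ts].
  by case: ts ts0 {tsP ts_orth ts_gen}.
set e := dims_of _.
pose t_ (i : 'I_(size [seq t.1.1 | t <- ts])) :=
  nth (1%N, 1%g, 1%g : GL (qudits R[i] n d)) ts i.
have lt_ts (i : 'I_(size [seq t.1.1 | t <- ts])) : (i < size ts)%N.
  by rewrite -(size_map (fun t => t.1.1) ts).
have t_ts i : t_ i \in ts by apply: mem_nth.
have eE i : e i = (t_ i).1.1 by rewrite /e /dims_of (nth_map (1%N, 1%g, 1%g)).
have ts_gt0 : (0 < size [seq t.1.1 | t <- ts])%N by rewrite size_map lt0n size_eq0.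
pose x i := (t_ i).1.2; pose z i := (t_ i).2.
have t_P i := tsP _ (t_ts i).
have t_orth i j : i != j -> orthogonal_pairs (t_ i) (t_ j).
  by move=> ij; apply: ts_orth.
have e_d i : (e i %| d)%N by rewrite eE; case: (t_P i).
have e_gt0 i : (0 < e i)%N by apply: dvdn_gt0 (e_d i).
have Nx i : normaliser_in (pauli n d zeta) H (x i) by case: (t_P i) => _ [].
have Nz i : normaliser_in (pauli n d zeta) H (z i) by case: (t_P i) => _ [].
have Hx i : H (x i ^+ e i)%g by rewrite eE; case: (t_P i).
have Hz i : H (z i ^+ e i)%g by rewrite eE; case: (t_P i).
have zx i : comm_exp (zt ^+ 2)%g (z i) (x i) (d %/ e i).
  by rewrite eE; case: (t_P i).
have xxC i j : commute (x i) (x j).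
  by have [->//|/t_orth[]] := eqVneq i j.
have zzC i j : commute (z i) (z j).
  by have [->//|/t_orth[]] := eqVneq i j.
have zxC i j : i != j -> commute (z i) (x j) by move=> /t_orth[].
have N_gen (S : set (GL (qudits R[i] n d))) : subgroup S -> S zt -> H `<=` S ->
    (forall i, S (x i) /\ S (z i)) -> normaliser_in (pauli n d zeta) H `<=` S.
  move=> sgS Szt HS Sxz; apply: ts_gen => // t /(nthP (1%N, 1%g, 1%g))[i lt_i <-].
  have lt_i' : (i < size [seq t.1.1 | t <- ts])%N by rewrite size_map.
  exact: (Sxz (Ordinal lt_i')).
have [w [Ww w1 zw]] := clock_fixed_vector d_gt0 sgH HP H_zt e_d Nx Nz Hz zx zzC zxC.
exists (frame_map e x w).
have [phi [phi_iso phi_eq]] := frame_quotient_iso d_gt0 sgH HP cH H_zt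
  (Ordinal ts_gt0) e_gt0 e_d Nx Nz Hx zx xxC zxC N_gen Ww w1 zw.
exists phi; split=> //.
split.
- exact: (frame_map_isometry d_gt0 sgH HP H_zt e_gt0 e_d Nx Nz zx zxC w1 zw).
- exact: (frame_map_range d_gt0 sgH HP H_zt (Ordinal ts_gt0) e_gt0 e_d Nx Nz Hx
    zx xxC zxC N_gen Ww w1 zw).
Qed.
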